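(* Let $b_0>0$. Consider the set $\mathcal{A}_1$ of admissible pairs $(b,f)$ with $b\in(0,b_0]$ and $f\in H$ such that $D[f]<\infty$, the lift constraint $$a_0(f)=\frac{4}{\pi b}$$ holds, and the moment constraint $$\frac{b^3}{4}\int_0^1\left|\int_\xi^1 f(\eta)\sqrt{1-\eta^2}\,(\eta-\xi)\,d\eta\right|d\xi\le 1$$ holds. Then there exists $(\tilde b,\tilde f)\in\mathcal{A}_1$ such that $$D[\tilde f]=\min_{(b,f)\in\mathcal{A}_1} D[f],$$ i.e. the infimum of $D$ over $\mathcal{A}_1$ is attained. No sign condition on $f$ (equivalently on the circulation $\Gamma(\xi)=f(\xi)\sqrt{1-\xi^2}$) or on the bending moment is imposed.
   Context: All physical constants (air density, freestream speed, total lift, and the moment bound) are normalized to $1$. $H$ denotes the real Hilbert space of even measurable functions $f:(-1,1)\to\mathbb{R}$ with $\int_{-1}^1 f(\xi)^2\sqrt{1-\xi^2}\,d\xi<\infty$, with inner product $(f,g)=\int_{-1}^1 f g\sqrt{1-\xi^2}\,d\xi$. $U_n$ denotes the Chebyshev polynomial of the second kind ($U_0=1$, $U_1=2x$, $U_{n+1}=2xU_n-U_{n-1}$); they satisfy $\int_{-1}^1U_nU_m\sqrt{1-x^2}\,dx=\frac{\pi}{2}\delta_{nm}$. For $f\in H$, set $a_n(f)=\frac{2}{\pi}\int_{-1}^1 f U_n\sqrt{1-\xi^2}\,d\xi$, so $f=\sum_{m\ge0}a_{2m}U_{2m}$ (odd coefficients vanish by evenness). The induced drag is $D[f]=\frac{\pi}{8}\sum_{m\ge0}(2m+1)a_{2m}(f)^2\in[0,\infty]$;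 it corresponds to a wing of span $b$ with circulation $\Gamma(x)=f(2x/b)\sqrt{1-(2x/b)^2}$, $x\in(-b/2,b/2)$, and is independent of $b$. The lift constraint expresses $\int_{-b/2}^{b/2}\Gamma(x)\,dx=1$ and the moment constraint expresses $\int_{-b/2}^{b/2}|M(x)|\,dx\le1$ with bending moment $M(x)=\int_{|x|}^{b/2}\Gamma(y)(y-|x|)\,dy$. *)

(* Defs.v *)
From HB Require Import structures.
From mathcomp Require Import all_boot all_order all_algebra.
From mathcomp Require Import all_classical all_reals all_analysis.
Set Implicit Arguments. Unset Strict Implicit. Unset Printing Implicit Defensive.
Import Order.TTheory GRing.Theory Num.Theory.
Import numFieldNormedType.Exports.
Local Open Scope classical_set_scope.
Local Open Scope ring_scope.

Section Wing.
Variable R : realType.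

Notation mu := (@lebesgue_measure R).

Fixpoint chebU (n : nat) (x : R) : R :=
  match n with
  | 0%N => 1
  | 1%N => 2 * x
  | (k.+1 as n').+1 => 2 * x * chebU n' x - chebU k x
  end.

Definition wgt (x : R) : R := Num.sqrt (1 - x ^+ 2).

Definition I11 : set R := `]-1, 1[%classic.

Definition inH (f : R -> R) : Prop :=
  [/\ measurable_fun I11 f,
      (forall x, I11 x -> f (- x) = f x) &
      mu.-integrable I11 (fun x => ((f x) ^+ 2 * wgt x)%:E)].

Definition coef (n : nat) (f : R -> R) : R :=
  2 / pi * Rintegral mu I11 (fun x => f x * chebU n x * wgt x).

Definition drag (f : R -> R) : \bar R :=
  (\sum_(0 <= m <oo) (pi / 8 * (2 * m%:R + 1) * (coef (2 * m) f) ^+ 2)%:E)%E.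

Definition inner_moment (f : R -> R) (xi : R) : R :=
  Rintegral mu `]xi, 1[%classic (fun eta => f eta * wgt eta * (eta - xi)).

Definition moment (b : R) (f : R -> R) : \bar R :=
  ((b ^+ 3 / 4)%:E * \int[mu]_(xi in `]0%R, 1%R[%classic) (`|inner_moment f xi|)%:E)%E.

Definition admissible1 (b0 b : R) (f : R -> R) : Prop :=
  [/\ 0 < b /\ b <= b0,
      inH f,
      (drag f < +oo)%E,
      coef 0 f = 4 / (pi * b) &
      (moment b f <= 1)%E].

End Wing.

(* Main.v *)
Require Import Defs.
From HB Require Import structures.
From mathcomp Require Import all_boot all_order all_algebra.
From mathcomp Require Import all_classical all_reals all_analysis.
From mathcomp Require Import measurable_realfun ring lra.
Set Implicit Arguments. Unset Strict Implicit. Unset Printing Implicit Defensive.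
Import Order.TTheory GRing.Theory Num.Theory.
Import numFieldNormedType.Exports.
Local Open Scope classical_set_scope.
Local Open Scope ring_scope.

(* The spans b of a minimizing sequence accumulate at some b* > 0, because the
   lift constraint makes the drag blow up as b -> 0. Rescaling the circulations
   to the span b* costs a factor tending to 1 in drag and moment, and the
   midpoint of two near-minimizers is again almost admissible, so by the
   parallelogram law the rescaled sequence is Cauchy for the drag seminorm and
   its Chebyshev coefficients converge in the l^2 space weighted by 2m + 1. The
   limit coefficients are those of an actual function: the dyadic partial sums
   of the Chebyshev series converge almost everywhere and are dominated in the
   weighted L^2 space. Finally the bending moment at xi is the pairing of f with
   (x - xi)_+, a uniform limit of polynomials, hence is controlled by the
   coefficients of f uniformly in xi; this passes the moment constraint to the
   limit. *)

(** * Chebyshev polynomials of the second kind *)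

(** Two obstacles shape the proof. The moment constraint is not convex in the pair of span and
    function; at a fixed span it is convex in f and the lift is linear, so all functions are moved
    to one span before midpoints are taken. Moreover the drag sees f only through its coefficients,
    whereas the moment is an integral of f itself, and the limit is built from coefficients alone.
    The bridge is that f and its truncated Chebyshev series have the same pairing with every
    polynomial of low degree, so the moment of a difference is bounded by the coefficients of that
    difference. Dyadic sums are taken because a bound on the sum of (2m + 1) a_m^2 makes the L^2
    norm of the block 2^k <= m < 2^(k+1) of order 2^(-k/2), which gives almost everywhere
    convergence by an elementary series estimate. *)

Section Chebyshev.
Variable R : realType.
Notation mu := (@lebesgue_measure R).
Notation chebU := (@chebU R).
Notation wgt := (@wgt R).
Notation I11 := (@I11 R).

Lemma nat_ind2 (P : nat -> Prop) :
  P 0%N -> P 1%N -> (forall n, P n -> P n.+1 -> P n.+2) -> forall n, P n.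
Proof.
move=> P0 P1 PS n; suff [] : P n /\ P n.+1 by [].
by elim: n => // n [Pn PSn]; split=> //; exact: PS.
Qed.

Lemma chebUSS n x : chebU n.+2 x = 2 * x * chebU n.+1 x - chebU n x.
Proof. by []. Qed.

Lemma chebUN n x : chebU n (- x) = (- 1) ^+ n * chebU n x.
Proof.
elim/nat_ind2: n => [|/=|n IH0 IH1]; rewrite ?expr0 ?mul1r ?expr1//; first by ring.
by rewrite !chebUSS IH0 IH1 !exprS; ring.
Qed.

(** Read off the recurrence, as 2 * 3 + 1 <= 9. The sharp bound is n + 1, but only boundedness of
    each [chebU n] on [I11] matters. *)
Lemma chebU_bounded n x : `|x| <= 1 -> `|chebU n x| <= 3 ^+ n.
Proof.
move=> x1; elim/nat_ind2: n => [|/=|n IH0 IH1].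
- by rewrite normr1.
- by rewrite normrM ger0_norm//; lra.
- rewrite chebUSS (le_trans (ler_normB _ _))// !normrM ger0_norm//.
  have : `|x| * `|chebU n.+1 x| <= 1 * 3 ^+ n.+1 by exact: ler_pM.
  have : 0 <= 3 ^+ n :> R by exact: exprn_ge0.
  move: IH0; rewrite !exprS; nra.
Qed.

Lemma continuous_mulf (f g : R -> R) : continuous f -> continuous g ->
  continuous (fun x => f x * g x).
Proof. by move=> cf cg x; apply: cvgM; [exact: cf|exact: cg]. Qed.

Lemma continuous_chebU n : continuous (chebU n).
Proof.
elim/nat_ind2: n => [|/=|n IH0 IH1] x.
- exact: cst_continuous.
- by apply: cvgM; [exact: cvg_cst|exact: cvg_id].
- apply: (@cvgB _ _ _ _ _ (fun x => 2 * x * chebU n.+1 x)).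
    by apply: cvgM; [apply: cvgM; [exact: cvg_cst|exact: cvg_id]|exact: IH1].
  exact: IH0.
Qed.

Lemma continuous_wgt : continuous wgt.
Proof.
move=> x; apply: (@continuous_comp _ _ _ (fun x : R => 1 - x ^+ 2) Num.sqrt).
  by apply: cvgB; [exact: cvg_cst|exact: exprn_continuous].
exact: sqrt_continuous.
Qed.

Lemma wgt_ge0 x : 0 <= wgt x. Proof. exact: sqrtr_ge0. Qed.

Lemma wgtN x : wgt (- x) = wgt x. Proof. by rewrite /Defs.wgt sqrrN. Qed.

Lemma wgt_gt0 x : I11 x -> 0 < wgt x.
Proof.
by rewrite /Defs.I11/= in_itv/= => /andP[? ?]; rewrite sqrtr_gt0; nra.
Qed.

Lemma sqr_wgt x : -1 <= x <= 1 -> wgt x ^+ 2 = 1 - x ^+ 2.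
Proof. by move=> /andP[? ?]; rewrite sqr_sqrtr//; nra. Qed.

(** * Derivatives, mass of the weight, orthogonality *)

Fixpoint dchebU (n : nat) (x : R) : R :=
  match n with
  | 0%N => 0
  | 1%N => 2
  | (k.+1 as n').+1 => 2 * chebU n' x + 2 * x * dchebU n' x - dchebU k x
  end.

Lemma is_derive_chebU n (x : R) : is_derive x (1 : R) (chebU n) (dchebU n x).
Proof.
elim/nat_ind2: n => [|/=|n IH0 IH1].
- exact: is_derive_cst.
- apply: is_derive_eq; rewrite /GRing.scale/=; ring.
- rewrite (_ : chebU n.+2 = (fun x => 2 * x * chebU n.+1 x - chebU n x))//.
  apply: is_derive_eq; rewrite /GRing.scale/=; ring.
Qed.

(** The classical (x^2 - 1) U_n' = (n + 1) T_(n+1) - x U_n, with T_(n+1) = U_(n+1) - x U_n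
    substituted. The factor 1 - x^2 is the square of [wgt]. *)
Lemma dchebUE n x :
  (1 - x ^+ 2) * dchebU n x = n.+2%:R * x * chebU n x - n.+1%:R * chebU n.+1 x.
Proof.
elim/nat_ind2: n => [|/=|n IH0 IH1].
- by rewrite /=; ring.
- by rewrite /=; ring.
- have -> : dchebU n.+2 x = 2 * chebU n.+1 x + 2 * x * dchebU n.+1 x - dchebU n x by [].
  rewrite mulrBr mulrDr IH0.
  rewrite (_ : _ * (2 * x * _) = 2 * x * ((1 - x ^+ 2) * dchebU n.+1 x)); last ring.
  by rewrite IH1 !chebUSS -!natr1; ring.
Qed.

Arguments Defs.chebU : simpl never.
Arguments dchebU : simpl never.

(* [measurableTypeR R] carries the display of [lebesgue_measure]. *)
Lemma measurable_I11 : measurable (I11 : set (measurableTypeR R)).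
Proof. exact: measurable_itv. Qed.

Lemma integrable_segment (a b : R) (f : R -> R) : continuous f ->
  mu.-integrable `[a, b] (EFin \o f).
Proof.
move=> cf; apply: continuous_compact_integrable; first exact: segment_compact.
exact: continuous_subspaceT.
Qed.

Lemma integrable_I11_continuous (f : R -> R) : continuous f ->
  mu.-integrable I11 (EFin \o f).
Proof.
move=> cf; apply: integrableS (integrable_segment (-1) 1 cf) => //.
- exact: measurable_I11.
- exact: subset_itv_oo_cc.
Qed.

(** Derivability is asked only inside the interval: the antiderivative it serves has the factor
    [wgt], which is not differentiable at -1 and 1. *)
Lemma Rintegral_I11_FTC (f F : R -> R) : continuous f -> continuous F ->
  (forall x : R, I11 x -> is_derive x (1 : R) F (f x)) ->
  Rintegral mu I11 f = F 1 - F (-1).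
Proof.
move=> cf cF dF; rewrite Rintegral_itv_bndo_bndc; last first.
  exact: integrable_I11_continuous.
rewrite Rintegral_itv_obnd_cbnd; last first.
  apply: integrableS (integrable_segment (-1) 1 cf) => //.
  exact: subset_itv_oc_cc.
rewrite /Rintegral (@continuous_FTC2 _ f F)//=.
- by apply: continuous_subspaceT.
- split => [x xI||]; first by have [] := dF _ xI.
  + exact/cvg_at_right_filter/cF.
  + exact/cvg_at_left_filter/cF.
- by move=> x xI; have := dF _ xI => h; rewrite derive1E derive_val.
Qed.

(* Antiderivative: w (U_(n+2) / (n+3) - U_n / (n+1)) / 2, vanishing at both ends. *)
Lemma integral_chebU_wgt n :
  Rintegral mu I11 (fun x => chebU n.+1 x * wgt x) = 0.
Proof.
pose Q x := (chebU n.+2 x / n.+3%:R - chebU n x / n.+1%:R) / 2.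
pose F x := wgt x * Q x.
have cF : continuous F.
  move=> x; apply: cvgM; first exact: continuous_wgt.
  apply: cvgM; last exact: cvg_cst.
  by apply: cvgB; apply: cvgM; try exact: cvg_cst; exact: continuous_chebU.
have dF (x : R) : x \in `]-1, 1[ -> is_derive x (1 : R) F (chebU n.+1 x * wgt x).
  move=> xI.
  have /andP[x1 x2] : -1 < x < 1 by move: xI; rewrite in_itv.
  have x0 : 0 < 1 - x ^+ 2 by nra.
  have d1 := is_derive_chebU n.+2 x.
  have d2 := is_derive_chebU n x.
  have dw : is_derive x 1 wgt (- x / wgt x).
    have ds := is_derive1_sqrt x0.
    have h : is_derive x 1 (Num.sqrt \o (fun x : R => 1 - x ^+ 2))
       ((2 * Num.sqrt (1 - x ^+ 2))^-1 * (- (2 * x))).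
      apply: (@is_derive1_comp _ Num.sqrt (fun x : R => 1 - x ^+ 2)).
      by apply: is_derive_eq; rewrite /GRing.scale/=; ring.
    apply: (@is_derive_eq _ _ _ _ _ _ _ _ h).
    by rewrite -/(wgt x); have := wgt_gt0 xI; move=> ?; field; rewrite gt_eqF.
  apply: is_derive_eq; rewrite /GRing.scale/= /Q.
  have w0 := wgt_gt0 xI.
  have w2 := sqr_wgt (introT andP (conj (ltW x1) (ltW x2))).
  (* Multiplying by [wgt x] clears the denominator of the derivative of [wgt] and creates the
     squares [wgt x ^+ 2] to which [dchebUE] applies. *)
  apply: (@mulfI _ (wgt x)); first by rewrite gt_eqF.
  have e1 := dchebUE n.+2 x.
  have e2 := dchebUE n x.
  set A := chebU n.+2 x in e1 *. set B := chebU n x in e2 *.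
  set C := chebU n.+1 x in e2 *.
  have eA : A = 2 * x * C - B by [].
  have eD : chebU n.+3 x = 2 * x * A - C by [].
  rewrite eD in e1.
  have n1 : n.+1%:R != 0 :> R by rewrite pnatr_eq0.
  have n3 : n.+3%:R != 0 :> R by rewrite pnatr_eq0.
  transitivity (((wgt x ^+ 2 * dchebU n.+2 x) / n.+3%:R - (wgt x ^+ 2 * dchebU n x) / n.+1%:R) / 2
    - x * (A / n.+3%:R - B / n.+1%:R) / 2); first by field; rewrite !nat1r -!natrD n1 -[(3 + n)%N]/n.+3 n3 gt_eqF.
  rewrite w2 e1 e2 (_ : _ * (C * _) = C * wgt x ^+ 2); last ring.
  rewrite w2 eA -!natr1; field.
  by rewrite !natr1 n1 n3.
have w1 : wgt 1 = 0 by rewrite /Defs.wgt expr1n subrr sqrtr0.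
rewrite (Rintegral_I11_FTC _ cF dF).
  by rewrite /F wgtN w1 !mul0r subrr.
by move=> x; apply: cvgM; [exact: continuous_chebU|exact: continuous_wgt].
Qed.

(** Substitution x = sin t: on [-pi/2, pi/2] the integrand becomes cos^2, with the explicit
    primitive [G]. The end points are first rewritten as sines to match the substitution rule. *)
Lemma integral_wgt : Rintegral mu I11 wgt = pi / 2.
Proof.
have intc : mu.-integrable I11 (EFin \o wgt).
  exact/integrable_I11_continuous/continuous_wgt.
rewrite Rintegral_itv_bndo_bndc//.
rewrite Rintegral_itv_obnd_cbnd; last first.
  apply: integrableS (integrable_segment (-1) 1 continuous_wgt) => //.
  exact: subset_itv_oc_cc.
have pi0 := pi_gt0 R.
have sinh : sin (pi / 2) = 1 :> R by exact: sin_pihalf.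
have sinNh : sin (- (pi / 2)) = -1 :> R by rewrite sinN sinh.
rewrite /Rintegral -[X in Interval (BLeft X) _]sinNh -[X in Interval _ (BRight X)]sinh.
have dsin : derive1 (@sin R) = cos.
  by apply/funext => x; rewrite derive1E derive_val.
rewrite integration_by_substitution_increasing; first last.
- exact/continuous_subspaceT/continuous_wgt.
- split => [x _||].
  + exact: derivable_sin.
  + exact/cvg_at_right_filter/continuous_sin.
  + exact/cvg_at_left_filter/continuous_sin.
- by rewrite dsin; apply/cvg_ex; exists (cos (pi / 2)); exact/cvg_at_left_filter/continuous_cos.
- by rewrite dsin; apply/cvg_ex; exists (cos (- (pi / 2))); exact/cvg_at_right_filter/continuous_cos.
- by rewrite dsin => x _; exact: continuous_cos.
- by move=> x y xI yI xy; rewrite ltr_sin.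
- lra.
rewrite dsin.
pose G (x : R) := (x + sin x * cos x) / 2.
have dG (x : R) : is_derive x (1 : R) G (cos x ^+ 2).
  apply: is_derive_eq; rewrite /GRing.scale/=.
  have := cos2Dsin2 x; nra.
transitivity (fine (\int[mu]_(x in `[(- (pi / 2))%R, (pi / 2)%R]) (cos x ^+ 2)%:E)%E).
  congr fine; apply: eq_integral => x; rewrite inE/= in_itv/= => xI; congr EFin.
  rewrite fctE/= -/(wgt (sin x)) /Defs.wgt -cos2sin2 sqrtr_sqr.
  by rewrite ger0_norm ?expr2// cos_ge0_pihalf.
rewrite (@continuous_FTC2 _ _ G)//=.
- rewrite /G cosN sinN cos_pihalf; lra.
- lra.
- by apply: continuous_subspaceT => x; apply: (@continuous_comp _ _ _ cos (fun x => x ^+ 2)); [exact: continuous_cos|exact: exprn_continuous].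
- have cG : continuous G.
    by move=> x; apply/differentiable_continuous/derivable1_diffP; have [] := dG x.
  split => [x xI||]; first by have [] := dG x.
  + exact/cvg_at_right_filter/cG.
  + exact/cvg_at_left_filter/cG.
- by move=> x xI; have := dG x => h; rewrite derive1E derive_val.
Qed.

Lemma chebU_orthogonal n m :
  Rintegral mu I11 (fun x => chebU n x * chebU m x * wgt x) = (n == m)%:R * (pi / 2).
Proof.
pose J n m := Rintegral mu I11 (fun x => chebU n x * chebU m x * wgt x).
have ci n' m' : continuous (fun x : R => chebU n' x * chebU m' x * wgt x).
  apply: (@continuous_mulf (fun x => chebU n' x * chebU m' x)); last exact: continuous_wgt.
  by apply: (@continuous_mulf (chebU n') (chebU m')); exact: continuous_chebU.
have ii n' m' : mu.-integrable I11 (fun x => (chebU n' x * chebU m' x * wgt x)%:E).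
  exact/integrable_I11_continuous/ci.
have J0 k : J k 0%N = (k == 0%N)%:R * (pi / 2).
  rewrite /J (_ : (fun x => _) = (fun x => chebU k x * wgt x)); last first.
    by apply/funext => x /=; rewrite mulr1.
  case: k => [|k]; last by rewrite integral_chebU_wgt mul0r.
  rewrite (_ : (fun x => _) = wgt); first by rewrite integral_wgt mul1r.
  by apply/funext => x; rewrite mul1r.
(* The factor 2x is moved from U_l to U_(k+1), where 2x U_(k+1) = U_(k+2) + U_k. The default 0 in
   the match stands for U_(-1) = 0. *)
have JS k l : J k.+1 l.+1 = J k.+2 l + J k l - (if l is l'.+1 then J k.+1 l' else 0).
  have -> : J k.+2 l + J k l = Rintegral mu I11
      (fun x => 2 * x * chebU k.+1 x * chebU l x * wgt x).
    rewrite /J -RintegralD; [|exact: measurable_I11|exact: ii|exact: ii].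
    by apply: eq_Rintegral => x _; rewrite chebUSS; ring.
  case: l => [|l].
    rewrite subr0; apply: eq_Rintegral => x _.
    by rewrite (_ : chebU 1 x = 2 * x)// (_ : chebU 0 x = 1)//; ring.
  rewrite /J -RintegralB; [|exact: measurable_I11| |exact: ii].
    by apply: eq_Rintegral => x _; rewrite (chebUSS l); ring.
  apply: integrable_I11_continuous.
  apply: (@continuous_mulf (fun x => 2 * x * chebU k.+1 x * chebU l.+1 x)); last exact: continuous_wgt.
  apply: (@continuous_mulf (fun x => 2 * x * chebU k.+1 x)); last exact: continuous_chebU.
  apply: (@continuous_mulf (fun x => 2 * x)); last exact: continuous_chebU.
  by apply: (@continuous_mulf (fun=> 2)) => x; [exact: cvg_cst|exact: cvg_id].
have J0r k : J 0%N k = J k 0%N.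
  by apply: eq_Rintegral => x _; rewrite [chebU 0 x * _]mulrC.
rewrite -/(J n m); elim/nat_ind2: m n => [n|[|n]|m IH0 IH1 [|n]].
- exact: J0.
- by rewrite J0r J0.
- by rewrite JS !J0 subr0 eqSS; case: n => [|n]; rewrite ?mul0r ?add0r.
- by rewrite J0r J0.
- rewrite JS IH1 IH1 IH0 !eqSS.
  case: (n =P m.+1) => [->|_]; last ring.
  by rewrite (gtn_eqF (_ : m < m.+2)%N)//; ring.
Qed.
End Chebyshev.
Arguments measurable_I11 {R}.

(** * The weighted pairing *)

Section Pairing.
Variable R : realType.
Notation mu := (@lebesgue_measure R).
Notation chebU := (@chebU R).
Notation wgt := (@wgt R).
Notation I11 := (@I11 R).

Definition L2w (f : R -> R) :=
  measurable_fun I11 f /\ mu.-integrable I11 (fun x => (f x ^+ 2 * wgt x)%:E).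

(** The test functions of the pairing are polynomials and tents, all bounded on [I11]; their
    products with [L2w] functions are integrable because |t| <= 1 + t^2. *)
Definition bdd (g : R -> R) :=
  measurable_fun I11 g /\ exists B, forall x, I11 x -> `|g x| <= B.

Definition ip (f g : R -> R) := Rintegral mu I11 (fun x => f x * g x * wgt x).

Lemma coef_ip n (f : R -> R) : coef n f = 2 / pi * ip f (chebU n). Proof. by []. Qed.

Lemma measurable_wgt : measurable_fun I11 wgt.
Proof.
by apply: measurable_funTS; apply: continuous_measurable_fun; exact: continuous_wgt.
Qed.

Lemma integrable_wgt : mu.-integrable I11 (EFin \o wgt).
Proof. exact/integrable_I11_continuous/continuous_wgt. Qed.

Lemma integrable_le (f g : R -> R) : measurable_fun I11 f ->
  (forall x, I11 x -> `|f x| <= g x) ->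
  mu.-integrable I11 (EFin \o g) -> mu.-integrable I11 (EFin \o f).
Proof.
move=> mf fg; apply: le_integrable; first exact: measurable_I11.
  exact/measurable_EFinP.
by move=> x Ix /=; rewrite lee_fin (le_trans (fg _ Ix))// ler_norm.
Qed.

Lemma integrable_lin (a b : R) (f g : R -> R) :
  mu.-integrable I11 (EFin \o f) -> mu.-integrable I11 (EFin \o g) ->
  mu.-integrable I11 (EFin \o (fun x => a * f x + b * g x)).
Proof.
move=> fi gi.
have := integrableD measurable_I11 (integrableZl measurable_I11 a fi)
  (integrableZl measurable_I11 b gi).
by apply: eq_integrable; [exact: measurable_I11|move=> x _ /=; rewrite EFinD !EFinM].
Qed.

Lemma integrable_scale (c : R) (f : R -> R) :
  mu.-integrable I11 (EFin \o f) -> mu.-integrable I11 (EFin \o (fun x => c * f x)).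
Proof.
move=> fi; have := integrableZl measurable_I11 c fi.
by apply: eq_integrable; [exact: measurable_I11|move=> x _ /=; rewrite EFinM].
Qed.

Lemma L2w_integrable f g : L2w f -> bdd g ->
  mu.-integrable I11 (EFin \o (fun x => f x * g x * wgt x)).
Proof.
move=> [mf fi] [mg [B gB]].
apply: (@integrable_le _ (fun x => B * wgt x + B * (f x ^+ 2 * wgt x))).
- by apply: measurable_funM; [exact: measurable_funM|exact: measurable_wgt].
- move=> x Ix; rewrite !normrM (ger0_norm (wgt_ge0 x)) -mulrDr mulrAC mulrC.
  apply: ler_pM => //; [exact: mulr_ge0 (wgt_ge0 x)|exact: gB|].
  rewrite -{2}(mul1r (wgt x)) -mulrDl ler_wpM2r ?wgt_ge0//.
  rewrite -real_normK ?num_real//; have := normr_ge0 (f x); nra.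
- by apply: integrable_lin => //; exact: integrable_wgt.
Qed.

Lemma bdd_L2w g : bdd g -> L2w g.
Proof.
move=> [mg [B gB]]; split=> //.
apply: (@integrable_le _ (fun x => B ^+ 2 * wgt x + 0 * wgt x)).
- by apply: measurable_funM; [exact: measurable_funX|exact: measurable_wgt].
- move=> x Ix; rewrite mul0r addr0 normrM (ger0_norm (wgt_ge0 x)).
  rewrite ler_wpM2r ?wgt_ge0// normrX ler_pXn2r ?nnegrE//; first exact: gB.
  exact: le_trans (normr_ge0 _) (gB _ Ix).
- by apply: integrable_lin => //; exact: integrable_wgt.
Qed.

Lemma L2w_lin (a b : R) f g : L2w f -> L2w g -> L2w (fun x => a * f x + b * g x).
Proof.
move=> [mf fi] [mg gi].
have m : measurable_fun I11 (fun x => a * f x + b * g x).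
  by apply: measurable_funD; apply: measurable_funM.
split=> //; apply: (@integrable_le _ (fun x => 2 * a ^+ 2 * (f x ^+ 2 * wgt x)
    + 2 * b ^+ 2 * (g x ^+ 2 * wgt x))).
- by apply: measurable_funM; [exact: measurable_funX|exact: measurable_wgt].
- move=> x Ix; rewrite ger0_norm; last by rewrite mulr_ge0 ?sqr_ge0 ?wgt_ge0.
  rewrite !mulrA -mulrDl ler_wpM2r ?wgt_ge0//.
  have := sqr_ge0 (a * f x - b * g x); nra.
- exact: integrable_lin.
Qed.

Lemma bdd_lin (a b : R) f g : bdd f -> bdd g -> bdd (fun x => a * f x + b * g x).
Proof.
move=> [mf [A fA]] [mg [B gB]]; split.
  by apply: measurable_funD; apply: measurable_funM.
exists (`|a| * A + `|b| * B) => x Ix.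
rewrite (le_trans (ler_normD _ _))// !normrM lerD// ler_wpM2l//; [exact: fA|exact: gB].
Qed.

Lemma bdd_cst c : bdd (fun=> c).
Proof. by split; [exact: measurable_cst|exists `|c|]. Qed.

Lemma bddM f g : bdd f -> bdd g -> bdd (fun x => f x * g x).
Proof.
move=> [mf [A fA]] [mg [B gB]]; split; first exact: measurable_funM.
by exists (A * B) => x Ix; rewrite normrM ler_pM//; [exact: fA|exact: gB].
Qed.

Lemma bdd_id : bdd id.
Proof.
split; first exact: measurable_id.
by exists 1 => x; rewrite /Defs.I11/= in_itv/= => /andP[? ?]; rewrite ler_norml; lra.
Qed.

Lemma I11_norm x : I11 x -> `|x| <= 1.
Proof. by rewrite /Defs.I11/= in_itv/= => /andP[? ?]; rewrite ler_norml; lra. Qed.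

Lemma bdd_chebU n : bdd (chebU n).
Proof.
split.
  by apply: measurable_funTS; apply: continuous_measurable_fun; exact: continuous_chebU.
by exists (3 ^+ n) => x Ix; exact/chebU_bounded/I11_norm.
Qed.

Lemma bdd_sum (I : Type) (s : seq I) (P : pred I) (F : I -> R -> R) :
  (forall i, bdd (F i)) -> bdd (fun x => \sum_(i <- s | P i) F i x).
Proof.
move=> bF; elim: s => [|i s IH].
  rewrite (_ : (fun x => _) = fun=> 0); first exact: bdd_cst.
  by apply/funext => x; rewrite big_nil.
rewrite (_ : (fun x => _) =
  (fun x => (P i)%:R * F i x + 1 * \sum_(j <- s | P j) F j x)).
  exact: bdd_lin.
by apply/funext => x; rewrite big_cons; case: (P i); rewrite ?mul1r ?mul0r ?add0r.
Qed.

Lemma ip_linl (a b : R) f g h : L2w f -> L2w g -> bdd h ->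
  ip (fun x => a * f x + b * g x) h = a * ip f h + b * ip g h.
Proof.
move=> Lf Lg bh; have fi := L2w_integrable Lf bh; have gi := L2w_integrable Lg bh.
rewrite /ip -!(RintegralZl _ measurable_I11)// -RintegralD//.
- by apply: eq_Rintegral => x _; ring.
- exact: measurable_I11.
- exact: integrableZl measurable_I11 _ _ fi.
- exact: integrableZl measurable_I11 _ _ gi.
Qed.

Lemma ip_linr (a b : R) f g h : L2w f -> bdd g -> bdd h ->
  ip f (fun x => a * g x + b * h x) = a * ip f g + b * ip f h.
Proof.
move=> Lf bg bh; have gi := L2w_integrable Lf bg; have hi := L2w_integrable Lf bh.
rewrite /ip -!(RintegralZl _ measurable_I11)// -RintegralD//.
- by apply: eq_Rintegral => x _; ring.
- exact: measurable_I11.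
- exact: integrableZl measurable_I11 _ _ gi.
- exact: integrableZl measurable_I11 _ _ hi.
Qed.

Lemma ipC f g : ip f g = ip g f.
Proof. by apply: eq_Rintegral => x _; rewrite [f x * _]mulrC. Qed.

Lemma eq_ip f f' g g' : (forall x, I11 x -> f x = f' x) ->
  (forall x, I11 x -> g x = g' x) -> ip f g = ip f' g'.
Proof. by move=> ff gg; apply: eq_Rintegral => x /set_mem Ix; rewrite ff// gg. Qed.

Lemma ip0l g : ip (fun=> 0) g = 0.
Proof.
rewrite /ip (_ : (fun x => _) = fun=> 0); last by apply/funext => x; rewrite !mul0r.
by rewrite Rintegral_cst ?mul0r//; exact: measurable_I11.
Qed.

Lemma ip0r f : ip f (fun=> 0) = 0.
Proof. by rewrite ipC ip0l. Qed.

Lemma ip_sumr (I : Type) (s : seq I) (c : I -> R) (F : I -> R -> R) f :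
  L2w f -> (forall i, bdd (F i)) ->
  ip f (fun x => \sum_(i <- s) c i * F i x) = \sum_(i <- s) c i * ip f (F i).
Proof.
move=> Lf bF; elim: s => [|i s IH].
  rewrite big_nil -[RHS](ip0r f); apply: eq_ip => // x _; exact: big_nil.
rewrite big_cons -IH -[X in _ + X]mul1r -ip_linr//.
- by apply: eq_ip => // x _; rewrite big_cons mul1r.
- by apply: bdd_sum => j; exact: (bddM (bdd_cst (c j)) (bF j)).
Qed.

Lemma ip_ge0 f : 0 <= ip f f.
Proof.
by apply: Rintegral_ge0 => x _; rewrite -expr2 mulr_ge0 ?sqr_ge0 ?wgt_ge0.
Qed.

(** Cauchy-Schwarz in Young form: expand the pairing of t f + g and of - t f + g with themselves and
    divide by t. The free parameter t is optimised by the caller. *)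
Lemma ip_young (t : R) f g : 0 < t -> bdd f -> bdd g ->
  `|ip f g| <= (t * ip f f + t^-1 * ip g g) / 2.
Proof.
move=> t0 bf bg.
have Lf := bdd_L2w bf. have Lg := bdd_L2w bg.
have key c : c ^+ 2 = t ^+ 2 -> 0 <= t * ip f f + 2 * (c / t) * ip f g + t^-1 * ip g g.
  move=> ct; have := ip_ge0 (fun x => c * f x + 1 * g x).
  have bh : bdd (fun x => c * f x + 1 * g x) by exact: bdd_lin.
  rewrite ip_linl// !ip_linr// (ipC g f) !mul1r => h.
  have : 0 <= (c * (c * ip f f + ip f g) + (c * ip f g + ip g g)) / t by rewrite divr_ge0// ltW.
  rewrite (_ : _ / t = (c ^+ 2 / t) * ip f f + 2 * (c / t) * ip f g + t^-1 * ip g g); last first.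
    by field; rewrite gt_eqF.
  by rewrite ct expr2 mulfK ?gt_eqF.
have := key t erefl; have := key (- t) (sqrrN _).
rewrite mulNr divff ?gt_eqF// => h1 h2.
by rewrite ler_norml; apply/andP; split; lra.
Qed.

(** * The weighted L^1 norm, and parity *)

Definition nrm1 (f : R -> R) := Rintegral mu I11 (fun x => `|f x| * wgt x).

Lemma integrable_nrm1 f : L2w f -> mu.-integrable I11 (EFin \o (fun x => `|f x| * wgt x)).
Proof.
move=> Lf; have := integrable_norm (L2w_integrable Lf (bdd_cst 1)).
apply: eq_integrable; first exact: measurable_I11.
by move=> x _ /=; rewrite mulr1 normrM (ger0_norm (wgt_ge0 x)).
Qed.

Lemma nrm1_ge0 f : 0 <= nrm1 f.
Proof. by apply: Rintegral_ge0 => x _; rewrite mulr_ge0 ?wgt_ge0. Qed.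

Lemma ip_le_nrm1 B f g : L2w f -> bdd g -> (forall x, I11 x -> `|g x| <= B) ->
  `|ip f g| <= B * nrm1 f.
Proof.
move=> Lf bg gB; have fi := L2w_integrable Lf bg.
have ni := integrable_nrm1 Lf.
rewrite (le_trans (le_normr_Rintegral measurable_I11 fi))//.
rewrite /nrm1 -(RintegralZl _ measurable_I11)//.
apply: le_Rintegral; first exact: measurable_I11.
- exact: integrable_norm fi.
- exact: integrableZl measurable_I11 _ _ ni.
- move=> x Ix; rewrite !normrM (ger0_norm (wgt_ge0 x)) mulrA ler_wpM2r ?wgt_ge0//.
  by rewrite mulrC ler_wpM2r// gB.
Qed.

Lemma Rintegral_I11_opp (h : R -> R) : mu.-integrable I11 (EFin \o h) ->
  Rintegral mu I11 (fun x => h (- x)) = Rintegral mu I11 h.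
Proof.
(* Extension by zero gives a function measurable on the whole line, where the reflection is carried
   out as a pushforward of [mu]. *)
move=> hi; pose h' := h \_ I11.
have IN x : I11 x -> I11 (- x).
  by rewrite /Defs.I11/= !in_itv/= => /andP[? ?]; apply/andP; split; lra.
have INE : (-%R : _ -> measurableTypeR R) @^-1` I11 = I11.
  by apply/seteqP; split=> x /= /IN//; rewrite opprK.
have hT : mu.-integrable setT (EFin \o h').
  by have := (integrable_mkcond _ measurable_I11).1 hi; rewrite restrict_EFin.
have mh' : measurable_fun setT h' by have /integrableP[/measurable_EFinP] := hT.
have hI : mu.-integrable I11 (EFin \o h').
  by apply: integrableS hT => //; exact: measurable_I11.
have e1 : Rintegral mu I11 (fun x => h (- x)) = Rintegral mu I11 (fun x => h' (- x)).
  by apply: eq_Rintegral => x /set_mem Ix; rewrite /h' /restrict mem_set//; exact: IN.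
have e2 : Rintegral mu I11 h = Rintegral mu I11 h'.
  by apply: eq_Rintegral => x /set_mem Ix; rewrite /h' /restrict mem_set.
rewrite e1 e2; congr fine.
have mo : measurable_fun [set: R] (-%R : _ -> measurableTypeR R).
  exact: oppr_measurable.
transitivity (\int[pushforward mu (-%R : _ -> measurableTypeR R)]_(x in I11) (h' (- x))%:E)%E.
  apply: eq_measure_integral => A mA _; apply/esym; exact: lebesgue_measureN.
rewrite integral_pushforward//=.
- by rewrite INE; apply: eq_integral => x _; rewrite /= opprK.
- exact/measurable_EFinP/measurableT_comp.
- rewrite INE; apply: eq_integrable hI; first exact: measurable_I11.
  by move=> x _ /=; rewrite opprK.
- exact: measurable_I11.
Qed.

Lemma ip_even_odd f g : L2w f -> bdd g ->
  (forall x, I11 x -> f (- x) = f x) -> (forall x, I11 x -> g (- x) = - g x) ->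
  ip f g = 0.
Proof.
move=> Lf bg fe go; have fi := L2w_integrable Lf bg.
have := Rintegral_I11_opp fi.
rewrite (_ : Rintegral _ _ _ = - ip f g) => [|].
  by rewrite /ip; lra.
have -> : - ip f g = -1 * ip f g by rewrite mulN1r.
rewrite /ip -(RintegralZl _ measurable_I11)//; apply: eq_Rintegral => x /set_mem Ix.
by rewrite fe// go// wgtN; ring.
Qed.

Lemma inH_L2w (f : R -> R) : inH f -> L2w f. Proof. by case. Qed.

Lemma coef_odd (f : R -> R) n : inH f -> odd n -> coef n f = 0.
Proof.
move=> [mf fe fi] on; rewrite coef_ip (ip_even_odd (f := f))// ?mulr0//.
- exact: bdd_chebU.
- by move=> x Ix; rewrite chebUN -signr_odd on expr1 mulN1r.
Qed.

End Pairing.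

(** * Pairings controlled by Chebyshev coefficients *)

Section KeyBound.
Variable R : realType.
Notation mu := (@lebesgue_measure R).
Notation chebU := (@chebU R).
Notation wgt := (@wgt R).
Notation I11 := (@I11 R).
Implicit Types f g : R -> R.

Lemma ip_chebU n m : ip (chebU n) (chebU m) = (n == m)%:R * (pi / 2).
Proof. exact: chebU_orthogonal. Qed.

(** Only even degrees occur, since the odd coefficients of an even function vanish; N terms reach
    degree 2N - 2. *)
Definition psum (a : nat -> R) N x := \sum_(m < N) a m * chebU (2 * m) x.

Lemma bdd_psum a N : bdd (psum a N).
Proof.
by apply: bdd_sum => m; apply: (bddM (bdd_cst _)); exact: bdd_chebU.
Qed.

Lemma ip_chebU_psum a N n : ip (chebU n) (psum a N) =
  \sum_(m < N) a m * ((n == 2 * m)%N%:R * (pi / 2)).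
Proof.
rewrite (ip_sumr _ (fun m : 'I_N => a m)).
- by apply: eq_bigr => m _; rewrite ip_chebU.
- exact/bdd_L2w/bdd_chebU.
- by move=> m; exact: bdd_chebU.
Qed.

Lemma ip_chebU_psum_even a N k : (k < N)%N ->
  ip (chebU (2 * k)) (psum a N) = a k * (pi / 2).
Proof.
move=> kN; rewrite ip_chebU_psum (bigD1 (Ordinal kN))//= eqxx mul1r big1 ?addr0//.
move=> i ik; rewrite eqn_mul2l/= (_ : (k == i) = false) ?mul0r ?mulr0//.
by apply: contraNF ik => /eqP ki; apply/eqP/val_inj.
Qed.

Lemma ip_chebU_psum_odd a N n : odd n -> ip (chebU n) (psum a N) = 0.
Proof.
move=> on; rewrite ip_chebU_psum big1// => i _.
rewrite (_ : (n == 2 * i)%N = false) ?mul0r ?mulr0//.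
by apply: contraTF on => /eqP ->; rewrite oddM.
Qed.

Lemma ip_psum a N : ip (psum a N) (psum a N) = pi / 2 * \sum_(m < N) a m ^+ 2.
Proof.
rewrite {2}/psum (ip_sumr _ (fun m : 'I_N => a m)).
- rewrite mulr_sumr; apply: eq_bigr => m _.
  by rewrite ipC ip_chebU_psum_even//; ring.
- exact/bdd_L2w/bdd_psum.
- by move=> m; exact: bdd_chebU.
Qed.

Notation cf f := (fun m => coef (2 * m) f).

Lemma ip_coef n f : ip f (chebU n) = pi / 2 * coef n f.
Proof.
rewrite coef_ip; move: (pi : R) (pi_gt0 R) => p p0.
by field; rewrite gt_eqF.
Qed.

(** Even n below 2N cancel against the partial sum; odd n give zero on both sides by parity. Hence
    degree 2N - 1 is covered too. *)
Lemma ip_residual f N n : inH f -> (n < 2 * N)%N ->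
  ip (fun x => 1 * f x + (-1) * psum (cf f) N x) (chebU n) = 0.
Proof.
move=> Hf nN; rewrite ip_linl; first last.
- exact: bdd_chebU.
- exact/bdd_L2w/bdd_psum.
- exact: inH_L2w.
rewrite mul1r mulN1r (ipC (psum _ _)) ip_coef.
have [on|en] := boolP (odd n).
  by rewrite coef_odd// ip_chebU_psum_odd// mulr0 subr0.
have nE : n = (2 * n./2)%N by rewrite mul2n even_halfK.
rewrite nE ip_chebU_psum_even ?(mulrC (pi / 2)) ?subrr//.
by move: nN; rewrite {1}nE ltn_mul2l.
Qed.

Lemma bdd_pow_chebU k n : bdd (fun x => x ^+ k * chebU n x).
Proof.
apply: bddM; last exact: bdd_chebU.
elim: k => [|k IH]; first exact: bdd_cst.
have := bddM (@bdd_id R) IH.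
by congr bdd; apply/funext => x; rewrite exprS.
Qed.

(** The extra factor [chebU n] closes the induction on k: x U_(n+1) = (U_(n+2) + U_n) / 2 trades a
    power of x for a shift of the index, and n + k never grows. *)
Lemma ip_residual_pow f N k n : inH f -> (n + k < 2 * N)%N ->
  ip (fun x => 1 * f x + (-1) * psum (cf f) N x) (fun x => x ^+ k * chebU n x) = 0.
Proof.
move=> Hf; set g := (fun x => 1 * f x + _).
have Lg : L2w g by apply: L2w_lin; [exact: inH_L2w|exact/bdd_L2w/bdd_psum].
elim: k n => [|k IH] n nkN.
  rewrite -(ip_residual Hf (_ : n < 2 * N)%N); last by rewrite addn0 in nkN.
  by apply: eq_ip => // x _; rewrite expr0 mul1r.
case: n nkN => [|n] nkN.
  (* Here x U_0 = U_1 / 2; the summand with coefficient 0 only gives the two-term shape of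
     [ip_linr]. *)
  rewrite (@eq_ip _ g g _ (fun x => 2^-1 * (x ^+ k * chebU 1 x) + 0 * (x ^+ k * chebU 0 x)))//.
    rewrite ip_linr//; try exact: bdd_pow_chebU.
    by rewrite IH ?mulr0 ?mul0r ?addr0.
  by move=> x _; rewrite (_ : chebU 0 x = 1)// (_ : chebU 1 x = 2 * x)// exprS; field.
rewrite (@eq_ip _ g g _ (fun x => 2^-1 * (x ^+ k * chebU n.+2 x) + 2^-1 * (x ^+ k * chebU n x)))//.
  rewrite ip_linr//; try exact: bdd_pow_chebU.
  rewrite !IH ?mulr0 ?addr0//.
  - by apply: leq_ltn_trans nkN; rewrite leq_add// -ltnS ltnW.
  - by rewrite addSn -addnS.
by move=> x _; rewrite chebUSS exprS; field.
Qed.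

Lemma bdd_horner (p : {poly R}) : bdd (horner p).
Proof.
rewrite (_ : horner p = (fun x => \sum_(i < size p) p`_i * x ^+ i)).
  apply: bdd_sum => i; apply: (bddM (bdd_cst _)).
  have := bdd_pow_chebU i 0; congr bdd; apply/funext => x.
  by rewrite mulr1.
by apply/funext => x; rewrite horner_coef.
Qed.

Lemma ip_residual_poly f N (p : {poly R}) : inH f -> (size p <= 2 * N)%N ->
  ip f (horner p) = ip (psum (cf f) N) (horner p).
Proof.
move=> Hf pN; set g := psum _ _.
suff : ip (fun x => 1 * f x + (-1) * g x) (horner p) = 0.
  rewrite ip_linl ?mul1r ?mulN1r; first by move/eqP; rewrite subr_eq0 => /eqP.
  - exact: inH_L2w.
  - exact/bdd_L2w/bdd_psum.
  - exact: bdd_horner.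
have Lg : L2w (fun x => 1 * f x + (-1) * g x).
  by apply: L2w_lin; [exact: inH_L2w|exact/bdd_L2w/bdd_psum].
rewrite (@eq_ip _ _ _ _ (fun x => \sum_(i < size p) p`_i * (x ^+ i * chebU 0 x)) (fun _ _ => erefl)).
  rewrite (ip_sumr _ (fun i : 'I_(size p) => p`_i))//.
    rewrite big1// => i _; rewrite ip_residual_pow ?mulr0// add0n.
    exact: leq_trans (ltn_ord i) pN.
  by move=> i; exact: bdd_pow_chebU.
by move=> x _; rewrite horner_coef; apply: eq_bigr => i _; rewrite mulr1.
Qed.

(** * Uniform approximation by polynomials, applied to the moment kernel *)

Definition polyapprox (phi : R -> R) := forall e : R, 0 < e ->
  exists p : {poly R}, forall x, I11 x -> `|phi x - p.[x]| <= e.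

Lemma ip_le_sq B g : bdd g -> (forall x, I11 x -> `|g x| <= B) ->
  ip g g <= B ^+ 2 * (pi / 2).
Proof.
(* The constant pi / 2 is the mass of the weight, written as the pairing of [chebU 0] with itself so
   that two integrals are compared. *)
move=> bg gB; rewrite -[pi / 2]mul1r -[1]/(true%:R) -(ip_chebU 0 0).
have Lg := bdd_L2w bg.
rewrite /ip -(RintegralZl _ measurable_I11); last first.
  by apply: L2w_integrable; [exact/bdd_L2w/bdd_chebU|exact: bdd_chebU].
apply: le_Rintegral; first exact: measurable_I11.
- exact: L2w_integrable.
- have ui := L2w_integrable (bdd_L2w (@bdd_chebU R 0)) (@bdd_chebU R 0).
  exact: integrableZl measurable_I11 _ _ ui.
- move=> x Ix; rewrite !mulr1 mul1r ler_wpM2r ?wgt_ge0//.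
  rewrite -expr2 -real_normK ?num_real// ler_pXn2r ?nnegrE//; first exact: gB.
  exact: le_trans (normr_ge0 _) (gB _ Ix).
Qed.

(* This avoids completeness of the U_n in the weighted L^2 space: [f] and its
   partial sum pair identically with a polynomial of low degree. *)
Lemma ip_bound f phi B s : inH f -> bdd phi -> polyapprox phi ->
  0 <= B -> (forall x, I11 x -> `|phi x| <= B) ->
  0 < s -> (forall N, \sum_(m < N) coef (2 * m) f ^+ 2 <= s ^+ 2) ->
  `|ip f phi| <= pi / 2 * (B + 1) * s.
Proof.
move=> Hf bphi phiP B0 phiB s0 Hs; have Lf := inH_L2w Hf.
apply/ler_addgt0Pr => e e0.
have [d [d0 d1 de]] : exists d, [/\ 0 < d, d <= 1 & d * nrm1 f <= e].
  (* The cap 1 keeps the polynomial below B + 1 on [I11]; the other bound makes the approximation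
     error at most e, even when [nrm1 f] vanishes. *)
  exists (Num.min 1 (e / (nrm1 f + 1))).
  have n1 : 0 < nrm1 f + 1 by rewrite ltr_wpDl ?nrm1_ge0.
  split; [by rewrite lt_min ltr01 divr_gt0|by rewrite ge_min lexx|].
  apply: (@le_trans _ _ (e / (nrm1 f + 1) * nrm1 f)).
    by rewrite ler_wpM2r ?nrm1_ge0// ge_min lexx orbT.
  by rewrite mulrAC ler_pdivrMr// ler_wpM2l ?lerDl ?ltW.
have [p pP] := phiP _ d0.
have bp := bdd_horner p.
have -> : ip f phi = ip f (horner p) + ip f (fun x => 1 * phi x + (-1) * p.[x]).
  by rewrite ip_linr//; ring.
rewrite (le_trans (ler_normD _ _))// lerD//; last first.
  apply: le_trans de; apply: ip_le_nrm1 => //; first exact: bdd_lin.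
  by move=> x Ix; rewrite mul1r mulN1r; exact: pP.
rewrite (@ip_residual_poly _ (size p))//; last by rewrite mul2n -addnn leq_addr.
(* This t makes both terms of Young's bound equal to pi / 2 * (B + 1) * s. *)
have t0 : 0 < (B + 1) / s by rewrite divr_gt0// ltr_wpDl.
apply: le_trans (ip_young t0 (bdd_psum _ _) bp) _.
have h1 : ip (psum (cf f) (size p)) (psum (cf f) (size p)) <= pi / 2 * s ^+ 2.
  by rewrite ip_psum ler_wpM2l// ?divr_ge0 ?pi_ge0.
have h2 : ip (horner p) (horner p) <= (B + 1) ^+ 2 * (pi / 2).
  apply: ip_le_sq => // x Ix.
  rewrite (_ : p.[x] = phi x - (phi x - p.[x])); last by ring.
  rewrite (le_trans (ler_normB _ _))// lerD//; first exact: phiB.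
  exact: le_trans (pP _ Ix) d1.
rewrite ler_pdivrMr//.
apply: (@le_trans _ _ ((B + 1) / s * (pi / 2 * s ^+ 2) + ((B + 1) / s)^-1 * ((B + 1) ^+ 2 * (pi / 2)))).
  by apply: lerD; apply: ler_wpM2l => //; rewrite ?invr_ge0 ltW.
rewrite le_eqVlt; apply/orP; left; apply/eqP; field.
by rewrite !gt_eqF// ltr_wpDl.
Qed.

(* Visser's iteration, increasing to |x| uniformly on [-1, 1]. *)
Fixpoint abs_poly (n : nat) : {poly R} :=
  if n is n'.+1 then abs_poly n' + 2^-1 *: ('X ^+ 2 - abs_poly n' ^+ 2) else 0.

(** The error satisfies e_(n+1) = e_n (1 - (|x| + p_n) / 2) <= e_n (1 - |x| / 2). The third clause
    is a division-free rate, inherited because (1 - z) (1 + (n + 1) z) <= 1 + n z with z = |x| /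
    2. *)
Lemma abs_polyP n x : `|x| <= 1 ->
  [/\ 0 <= (abs_poly n).[x], (abs_poly n).[x] <= `|x| &
   (`|x| - (abs_poly n).[x]) * (1 + n%:R * (`|x| / 2)) <= `|x|].
Proof.
move=> x1; have x0 := normr_ge0 x; elim: n => [|n [IH0 IH1 IH2]].
  by rewrite /= horner0 mul0r addr0 mulr1 subr0.
rewrite /= hornerD hornerZ hornerD hornerN !horner_exp hornerX -(real_normK (num_real x)) -[n.+1%:R]natr1.
have n0 : 0 <= n%:R :> R by [].
move: (n%:R : R) n0 `|x| x0 x1 (abs_poly n).[x] IH0 IH1 IH2 => k k0 y y0 y1 q q0 q1 h.
have yq0 : 0 <= (y - q) * (y + q) by apply: mulr_ge0; lra.
have yq1 : 0 <= (y - q) * (1 - (y + q) / 2) by apply: mulr_ge0; lra.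
split; [lra|lra|].
have e1 : y - (q + 2^-1 * (y ^+ 2 - q ^+ 2)) = (y - q) * (1 - (y + q) / 2) by field.
rewrite e1.
have : (y - q) * (1 - (y + q) / 2) <= (y - q) * (1 - y / 2) by nra.
have : 0 <= 1 + (k + 1) * (y / 2) by nra.
have : (1 - y / 2) * (1 + (k + 1) * (y / 2)) <= 1 + k * (y / 2) by nra.
move=> a1 a2 a3.
apply: (@le_trans _ _ ((y - q) * (1 - y / 2) * (1 + (k + 1) * (y / 2)))); first exact: ler_wpM2r.
apply: le_trans h; rewrite -mulrA; apply: ler_wpM2l; [lra|exact: a1].
Qed.

(** Drop the 1 in the third clause of [abs_polyP] and cancel |x|, which leaves a rate uniform in x.
    At x = 0 nothing can be cancelled, but the error is zero. *)
Lemma abs_poly_err n x : `|x| <= 1 -> `| `|x| - (abs_poly n).[x] | * n%:R <= 2.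
Proof.
move=> x1; have [q0 q1 h] := abs_polyP n x1.
rewrite ger0_norm ?subr_ge0//.
have n0 : 0 <= n%:R :> R by [].
have [x0|x0] := eqVneq x 0.
  have -> : `|x| - (abs_poly n).[x] = 0 by move: q0 q1; rewrite x0 normr0; lra.
  by rewrite mul0r.
have y0 : 0 < `|x| by rewrite normr_gt0.
rewrite -(ler_pM2r y0); move: h q1.
move: (n%:R : R) n0 `|x| y0 x1 (abs_poly n).[x] q0 => k k0 y y0 y1 q q0 h q1.
nra.
Qed.

Definition tent (xi x : R) : R := Num.max (x - xi) 0.

(** The halving brings the argument of the absolute value into [-1, 1] for x in [I11] and xi in
    [0, 1], where [abs_poly] converges. *)
Lemma tentE xi x : tent xi x = (x - xi) / 2 + `|(x - xi) / 2|.
Proof.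
rewrite normrM [`|2^-1|]ger0_norm ?invr_ge0//; rewrite /tent.
by case: (leP (x - xi) 0) => h; [rewrite ler0_norm|rewrite gtr0_norm]; lra.
Qed.

Lemma tent_polyapprox xi : 0 <= xi <= 1 -> polyapprox (tent xi).
Proof.
move=> /andP[xi0 xi1] e e0.
have [n n2] : exists n : nat, 2 / e < n%:R.
  by exists (Num.truncn (2 / e)).+1; exact: truncnS_gt.
pose q : {poly R} := 2^-1 *: ('X - xi%:P).
exists (q + (abs_poly n \Po q)) => x Ix.
have qx : q.[x] = (x - xi) / 2.
  by rewrite /q hornerZ hornerD hornerN hornerX hornerC mulrC.
rewrite hornerD horner_comp qx tentE.
have y1 : `|(x - xi) / 2| <= 1.
  move: Ix; rewrite /Defs.I11/= in_itv/= => /andP[? ?].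
  by rewrite ler_norml; lra.
rewrite (_ : _ - _ = `|(x - xi) / 2| - (abs_poly n).[(x - xi) / 2]); last by ring.
have h := abs_poly_err n y1.
have n0 : 0 < n%:R :> R by apply: lt_trans n2; rewrite divr_gt0.
rewrite -(ler_pM2r n0); apply: le_trans h _.
by move: n2; rewrite ltr_pdivrMr// => /ltW; rewrite mulrC.
Qed.

Lemma tent_bound xi x : 0 <= xi <= 1 -> I11 x -> `|tent xi x| <= 2.
Proof.
move=> /andP[xi0 xi1]; rewrite /Defs.I11/= in_itv/= => /andP[? ?].
rewrite /tent ger0_norm ?le_max ?lexx ?orbT// ge_max; apply/andP; split; lra.
Qed.

Lemma bdd_tent xi : bdd (tent xi).
Proof.
split.
  apply: measurable_funTS; apply: measurable_maxr => //.
  exact: measurable_funB.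
exists (1 + `|xi|) => x /I11_norm x1.
rewrite /tent; have := ler_norm x; have := ler_norm (- xi); rewrite normrN => ? ?.
have := normr_ge0 xi => ?.
by rewrite ger0_norm ?le_max ?lexx ?orbT// ge_max; apply/andP; split; lra.
Qed.

Lemma inner_momentE f xi : 0 <= xi -> inner_moment f xi = ip f (tent xi).
Proof.
move=> xi0; rewrite /inner_moment.
have -> : `]xi, 1[%classic = I11 `&` `]xi, 1[%classic.
  apply/esym/setIidr => x; rewrite /Defs.I11/= !in_itv/= => /andP[? ->].
  by rewrite andbT; lra.
rewrite Rintegral_mkcondr; apply: eq_Rintegral => x.
rewrite inE /Defs.I11/= in_itv/= => /andP[x1 x2].
rewrite /restrict /tent; case: ifPn => h.
  move: h; rewrite inE/= in_itv/= => /andP[h _].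
  by rewrite max_l; [ring|lra].
rewrite max_r ?mulr0 ?mul0r//.
rewrite leNgt; apply: contra h => h; rewrite inE/= in_itv/= x2 andbT; lra.
Qed.

End KeyBound.

(** * Functions with prescribed Chebyshev coefficients *)

Section Synthesis.
Variable R : realType.
Notation mu := (@lebesgue_measure R).
Notation chebU := (@chebU R).
Notation wgt := (@wgt R).
Notation I11 := (@I11 R).
Implicit Types f g : R -> R.
Variables (a : nat -> R) (S : R).
Hypothesis aS : forall N, \sum_(m < N) (2 * m%:R + 1) * a m ^+ 2 <= S.

Let T k x := psum a (2 ^ k) x.
(** The upper cut at 2^(k+1) is the number of terms in [u]. Written as a [psum], the block has its
    norm computed by [ip_psum]. *)
Let block k m := if (2 ^ k <= m)%N then a m else 0.
Let u k x := psum (block k) (2 ^ k.+1) x.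

Let TS k x : T k.+1 x = T k x + u k x.
Proof.
rewrite /T /u /psum /block.
rewrite [X in _ = _ + X](eq_bigr (fun m : 'I__ => if (2 ^ k <= m)%N then a m * chebU (2 * m) x else 0)); last first.
  by move=> m _; case: ifP => // _; rewrite mul0r.
rewrite -big_mkcond/= -(big_geq_mkord _ _ xpredT (fun m => a m * chebU (2 * m) x)).
rewrite -!(big_mkord xpredT (fun m => a m * chebU (2 * m) x)).
by rewrite -big_cat_nat//= leq_exp2l.
Qed.

Let T0 x : T 0%N x = a 0%N.
Proof. by rewrite /T /psum big_ord_recl big_ord0 addr0 muln0 mulr1. Qed.

(* [2 ^ k] is the order of the weights (2m + 1) in the k-th dyadic block, so
   [B k] stays integrable while dominating the square of the telescoped sum. *)
Let B k x := \sum_(j < k) 2 ^+ j * u j x ^+ 2.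

Let B_ge0 k x : 0 <= B k x.
Proof. by apply: sumr_ge0 => j _; rewrite mulr_ge0 ?sqr_ge0. Qed.

(** Cauchy-Schwarz for the telescoped sum with weights 2^j: the constant is the sum of 2^(-j) over j
    < k. *)
Let TB k x : (T k x - a 0%N) ^+ 2 <= (2 - 2 / 2 ^+ k) * B k x.
Proof.
elim: k => [|k IH].
  by rewrite T0 subrr expr0n/= expr0 divr1 subrr mul0r.
have BS : B k.+1 x = B k x + 2 ^+ k * u k x ^+ 2 by rewrite /B big_ord_recr.
rewrite TS BS [2 ^+ k.+1]exprS.
have p0 : 0 < 2 ^+ k :> R by rewrite exprn_gt0.
have p1 : 1 <= 2 ^+ k :> R by rewrite exprn_ege1// ler1n.
have b0 := B_ge0 k x.
move: (2 ^+ k : R) p0 p1 (B k x) b0 (u k x) (T k x) IH => p p0 p1 b b0 v t IH.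
rewrite (_ : t + v - a 0%N = (t - a 0%N) + v); last by ring.
move: (t - a 0%N) IH => A IH.
pose e := p^-1.
have e0 : 0 < e by rewrite invr_gt0.
have e1 : e <= 1 by rewrite invf_le1.
have -> : 2 / (2 * p) = e by rewrite /e; field; rewrite gt_eqF.
have IH' : A ^+ 2 <= (2 - 2 * e) * b by [].
have pe : p * e = 1 by rewrite /e divff// gt_eqF.
(* The factor s vanishes only for e = 1, that is k = 0; then A = 0, while the identity below divides
   by s. *)
have [s0|s0] := leP (2 - 2 * e) 0.
  have e1' : e = 1 by lra.
  have -> : A = 0.
    by apply/eqP; rewrite -sqrf_eq0 eq_le sqr_ge0 andbT; move: IH'; rewrite e1'; lra.
  have p1' : p = 1 by rewrite -pe e1' mulr1.
  rewrite p1' e1'; nra.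
set s := 2 - 2 * e in s0 IH' *.
have -> : 2 - e = s + e by rewrite /s; ring.
rewrite -subr_ge0.
(* Certificate for (A + v)^2 <= (s + e) (A^2 / s + v^2 / e), combined with A^2 <= s b and p = 1 /
   e. *)
have -> : (s + e) * (b + p * v ^+ 2) - (A + v) ^+ 2 =
   (s * b - A ^+ 2) + p / s * ((e ^+ 2 * s) * (b * s - A ^+ 2) / s  + (e * A - s * v) ^+ 2).
  have -> : p = e^-1 by rewrite /e invrK.
  by field; rewrite !gt_eqF.
apply: addr_ge0; first by rewrite subr_ge0.
apply: mulr_ge0; first by rewrite divr_ge0// ltW.
apply: addr_ge0; last exact: sqr_ge0.
apply: divr_ge0; last exact: ltW.
apply: mulr_ge0; first by rewrite mulr_ge0 ?sqr_ge0 ?ltW.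
by rewrite subr_ge0 mulrC.
Qed.

Let T_sqr k x : T k x ^+ 2 <= 2 * a 0%N ^+ 2 + 4 * B k x.
Proof.
have h1 := TB k x; have b0 := B_ge0 k x.
have h2 : (2 - 2 / 2 ^+ k) * B k x <= 2 * B k x.
  by rewrite ler_wpM2r// gerBl divr_ge0.
(* This square is 2 a_0^2 + 2 (T - a_0)^2 - T^2. *)
have := sqr_ge0 (T k x - 2 * a 0%N); nra.
Qed.

Let ip_block k : 2 ^+ k * ip (u k) (u k) <=
  pi / 2 * \sum_(2 ^ k <= m < 2 ^ k.+1) (2 * m%:R + 1) * a m ^+ 2.
Proof.
rewrite /u ip_psum mulrCA ler_wpM2l ?divr_ge0 ?pi_ge0//.
rewrite mulr_sumr.
rewrite (eq_bigr (fun m : 'I__ => if (2 ^ k <= m)%N then 2 ^+ k * a m ^+ 2 else 0)); last first.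
  by move=> m _; rewrite /block; case: ifP => // _; rewrite expr0n mulr0.
rewrite -big_mkcond/= -(big_geq_mkord _ _ xpredT (fun m => 2 ^+ k * a m ^+ 2)).
rewrite big_nat [X in _ <= X]big_nat; apply: ler_sum => m /andP[km _].
rewrite ler_wpM2r ?sqr_ge0//.
have : (2 ^ k)%:R <= m%:R :> R by rewrite ler_nat.
rewrite natrX; have : 0 <= m%:R :> R by []. lra.
Qed.

Let ip_B k : \sum_(j < k) 2 ^+ j * ip (u j) (u j) <= pi / 2 * S.
Proof.
have h : \sum_(j < k) 2 ^+ j * ip (u j) (u j) <=
    pi / 2 * \sum_(1 <= m < 2 ^ k) (2 * m%:R + 1) * a m ^+ 2.
  elim: k => [|k IH]; first by rewrite big_ord0 big_geq// mulr0.
  rewrite big_ord_recr/= (big_cat_nat _ (n := 2 ^ k)) ?expn_gt0 ?leq_exp2l//= mulrDr.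
  exact: lerD (IH) (ip_block k).
apply: le_trans h _; rewrite ler_wpM2l ?divr_ge0 ?pi_ge0//.
apply: le_trans (aS (2 ^ k)); rewrite -(big_mkord xpredT (fun m => (2 * m%:R + 1) * a m ^+ 2)).
rewrite [X in _ <= X](big_cat_nat _ (n := 1)) ?expn_gt0//= ler_wpDl//.
by rewrite big_nat1 mulr0 add0r mul1r sqr_ge0.
Qed.

(** The monotone limit of [B k] times the weight. It takes values in the extended reals so as to
    exist everywhere; its integrability makes it finite almost everywhere. *)
Let Gw x : \bar R := (\sum_(0 <= j <oo) (2 ^+ j * u j x ^+ 2 * wgt x)%:E)%E.

Let Gw_term_ge0 j x : (0 <= (2 ^+ j * u j x ^+ 2 * wgt x)%:E)%E.
Proof. rewrite lee_fin; apply: mulr_ge0; [apply: mulr_ge0; [exact: exprn_ge0|exact: sqr_ge0]|exact: wgt_ge0]. Qed.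

Let bu j : bdd (u j). Proof. exact: bdd_psum. Qed.
Let bT j : bdd (T j). Proof. exact: bdd_psum. Qed.

Let BGw k x : ((B k x * wgt x)%:E <= Gw x)%E.
Proof.
rewrite /B mulr_suml -sumEFin.
apply: le_trans (nneseries_lim_ge k (fun n _ _ => Gw_term_ge0 n x)).
by rewrite big_mkord.
Qed.

Let iterm j : mu.-integrable I11 (EFin \o (fun x => 2 ^+ j * u j x ^+ 2 * wgt x)).
Proof.
have := L2w_integrable (bdd_L2w (bddM (bdd_cst (2 ^+ j)) (bu j))) (bu j).
apply: eq_integrable; first exact: measurable_I11.
by move=> x _ /=; rewrite expr2 mulrA.
Qed.

Let mGw : measurable_fun I11 Gw.
Proof.
apply: ge0_emeasurable_sum => [k x _ _|k _]; first exact: Gw_term_ge0.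
exact: (measurable_int mu (iterm k)).
Qed.

Let integrable_Gw : mu.-integrable I11 Gw.
Proof.
have G0 x : (0 <= Gw x)%E by apply: nneseries_ge0 => n _ _; exact: Gw_term_ge0.
apply/integrableP; split=> //.
under eq_integral => x _ do rewrite gee0_abs//.
rewrite integral_nneseries//; first last.
- by move=> n; exact: (measurable_int mu (iterm n)).
- exact: measurable_I11.
apply: (@le_lt_trans _ _ (pi / 2 * S)%:E); last exact: ltry.
apply: lime_le.
  by apply: is_cvg_nneseries => n _ _; apply: integral_ge0.
apply: nearW => n.
rewrite (eq_bigr (fun j => (2 ^+ j * ip (u j) (u j))%:E)).
  by rewrite sumEFin lee_fin big_mkord.
move=> j _; rewrite -(fineK (integrable_fin_num measurable_I11 (iterm j))).
congr EFin; rewrite /ip -(RintegralZl _ measurable_I11); last exact: L2w_integrable (bdd_L2w (bu j)) (bu j).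
by apply: eq_Rintegral => x _; ring.
Qed.

(* The limsup, rather than the limit of the almost everywhere convergent dyadic
   sums, gives a measurable function whose evenness holds at every point. *)
Definition synth x : R := fine (limn_esup (fun k => (T k x)%:E)).

(** Where [Gw] is finite, |u_k| <= (2^(-k) + 2^k u_k^2) / 2 makes the telescoping series absolutely
    convergent, and the limsup is then a limit. *)
Let T_cvg x : I11 x -> Gw x \is a fin_num -> T ^~ x @ \oo --> synth x.
Proof.
move=> Ix Gx.
have w0 := wgt_gt0 Ix.
pose M := fine (Gw x) / wgt x.
have BM k : B k x <= M.
  by rewrite ler_pdivlMr// -lee_fin fineK//; exact: BGw.
have cu : cvgn (series (fun k => u k x)).
  apply: normed_cvg; apply: nondecreasing_is_cvgn.
    by apply: (@nondecreasing_series _ (fun k => `|u k x|) xpredT 0%N).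
  exists (1 + M) => _ [n _ <-].
  rewrite [X in X <= _](_ : _ = \sum_(0 <= k < n) `|u k x|)//.
  (* The exact geometric partial sum is kept, since the cruder bound 1 + M would not pass through
     the induction. *)
  apply: (@le_trans _ _ ((2 - 2 / 2 ^+ n) / 2 + B n x / 2)); last first.
    have := BM n; have := B_ge0 n x; have : 0 <= 2 / 2 ^+ n :> R by rewrite divr_ge0.
    lra.
  elim: n => [|n IH].
    by rewrite big_geq// /B big_ord0 expr0 divr1 subrr !mul0r addr0.
  rewrite big_nat_recr//= /B big_ord_recr/= -/(B n x).
  have h : `|u n x| <= (2 ^+ n)^-1 / 2 + 2 ^+ n * u n x ^+ 2 / 2.
    rewrite -[u n x ^+ 2]real_normK ?num_real//.
    have p0 : 0 < 2 ^+ n :> R by rewrite exprn_gt0.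
    rewrite -subr_ge0.
    rewrite (_ : _ - _ = (2 ^+ n * `|u n x| - 1) ^+ 2 / (2 * 2 ^+ n)).
      by rewrite divr_ge0 ?sqr_ge0// mulr_ge0// ltW.
    by field; rewrite gt_eqF.
  have e : 2 / 2 ^+ n.+1 = 2 / 2 ^+ n - (2 ^+ n)^-1 :> R.
    by rewrite exprS; field; rewrite gt_eqF// exprn_gt0.
  by rewrite e; lra.
have TE : T ^~ x = (fun k => a 0%N + series (fun k => u k x) k).
  apply/funext => k; elim: k => [|k IH]; first by rewrite T0 /series/= big_geq// addr0.
  by rewrite TS IH /series/= big_nat_recr//= addrA.
have cT : cvgn (T ^~ x).
  by rewrite TE; apply: is_cvgD => //; exact: is_cvg_cst.
have h : (fun k => (T k x)%:E) @ \oo --> (limn (T ^~ x))%:E.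
  by apply: cvg_EFin => //; exact: nearW.
by rewrite /synth (cvg_limn_einf_sup h).2.
Qed.

Let ae_cvg : {ae mu, forall x, I11 x -> T ^~ x @ \oo --> synth x}.
Proof.
apply: filterS (integrable_ae measurable_I11 integrable_Gw) => x h Ix.
exact: T_cvg (h Ix).
Qed.

Let msynth : measurable_fun I11 synth.
Proof.
apply: measurableT_comp; first exact: fine_measurable.
apply: measurable_fun_limn_esup => k.
by apply/measurable_EFinP; have [] := bT k.
Qed.

Let dom x : \bar R := ((2 * a 0%N ^+ 2 * wgt x)%:E + 4%:E * Gw x)%E.

Let idom : mu.-integrable I11 dom.
Proof.
apply: integrableD; first exact: measurable_I11.
  exact: integrable_scale (@integrable_wgt R).
exact: (integrableZl measurable_I11 4 integrable_Gw).
Qed.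

Let Tdom k x : ((T k x ^+ 2 * wgt x)%:E <= dom x)%E.
Proof.
apply: (@le_trans _ _ (2 * a 0%N ^+ 2 * wgt x + 4 * (B k x * wgt x))%:E).
  by rewrite lee_fin mulrA -mulrDl ler_wpM2r ?wgt_ge0.
by rewrite EFinD leeD2l// EFinM lee_wpmul2l//; exact: BGw.
Qed.

Let L2w_synth : L2w synth.
Proof.
split=> //.
have [] := @dominated_convergence _ _ _ mu I11 measurable_I11
  (fun k x => (T k x ^+ 2 * wgt x)%:E) (fun x => (synth x ^+ 2 * wgt x)%:E) dom.
- move=> k; apply/measurable_EFinP; apply: measurable_funM; last exact: measurable_wgt.
  by apply: measurable_funX; have [] := bT k.
- apply/measurable_EFinP; apply: measurable_funM; last exact: measurable_wgt.
  exact: measurable_funX.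
- apply: negligibleS ae_cvg; apply: subsetC => x h Ix; apply: cvg_EFin; first exact: nearW.
  by apply: cvgM; [exact: (cvg_comp _ _ (h Ix) (@exprn_continuous _ _ _))|exact: cvg_cst].
- exact: idom.
- apply: aeW => x k Ix; rewrite gee0_abs; first exact: Tdom.
  by rewrite lee_fin mulr_ge0 ?sqr_ge0 ?wgt_ge0.
- by [].
Qed.

Let ip_synth g : bdd g -> (fun k => ip (T k) g) @ \oo --> ip synth g.
Proof.
move=> bg; have [mg [C gC]] := bg.
pose C' := `|C|.
have [] := @dominated_convergence _ _ _ mu I11 measurable_I11
  (fun k x => (T k x * g x * wgt x)%:E) (fun x => (synth x * g x * wgt x)%:E)
  (* From |T| <= 1 + T^2, so the majorant of the squares serves for the pairings too. *)
  (fun x => (C' * wgt x)%:E + C'%:E * dom x)%E.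
- by move=> k; apply: (measurable_int mu); exact: L2w_integrable (bdd_L2w (bT k)) bg.
- by apply: (measurable_int mu); exact: L2w_integrable L2w_synth bg.
- apply: negligibleS ae_cvg; apply: subsetC => x h Ix; apply: cvg_EFin; first exact: nearW.
  by apply: cvgM; [apply: cvgM; [exact: h|exact: cvg_cst]|exact: cvg_cst].
- apply: integrableD; first exact: measurable_I11.
    exact: integrable_scale (@integrable_wgt R).
  exact: (integrableZl measurable_I11 C' idom).
- apply: aeW => x k Ix.
  apply: (@le_trans _ _ ((C' * wgt x)%:E + C'%:E * (T k x ^+ 2 * wgt x)%:E)%E).
    rewrite lee_fin !normrM (ger0_norm (wgt_ge0 x)).
    rewrite mulrA -mulrDl ler_wpM2r ?wgt_ge0//.
    rewrite -[X in X + _]mulr1 -mulrDr mulrC ler_pM//.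
      by rewrite (le_trans (gC _ Ix))// ler_norm.
    rewrite -real_normK ?num_real//; have := normr_ge0 (T k x); nra.
  by rewrite leeD2l// lee_wpmul2l// lee_fin normr_ge0.
move=> _ _ h.
have i1 := integrable_fin_num measurable_I11 (L2w_integrable L2w_synth bg).
have i2 k := integrable_fin_num measurable_I11 (L2w_integrable (bdd_L2w (bT k)) bg).
by apply: fine_cvg; rewrite fineK.
Qed.

Lemma inH_synth : inH synth.
Proof.
have [m i] := L2w_synth; split=> // x _.
rewrite /synth; congr (fine (limn_esup _)); apply/funext => k; congr EFin.
apply: eq_bigr => m' _; rewrite chebUN -signr_odd.
by rewrite oddM/= mul1r.
Qed.

(** The pairings of [T k] with U_(2m) are constant once 2^k > m, hence equal to their limit. *)
Lemma coef_synth m : coef (2 * m) synth = a m.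
Proof.
have bm := @bdd_chebU R (2 * m).
have h := ip_synth bm.
have h' : (fun k => ip (T k) (chebU (2 * m))) @ \oo --> a m * (pi / 2).
  apply: cvg_near_cst; near=> k.
  have mk : (m <= k)%N by near: k; exists m.
  have mk2 : (m < 2 ^ k)%N := leq_ltn_trans mk (ltn_expl k (isT : 1 < 2)%N).
  by rewrite ipC (ip_chebU_psum_even a mk2).
have e := cvg_unique _ h h'.
rewrite coef_ip e //; move: (pi : R) (pi_gt0 R) => p p0.
by field; rewrite gt_eqF.
Unshelve. all: by end_near. Qed.

End Synthesis.

(** * Drag and bending moment *)

Section Functionals.
Variable R : realType.
Notation mu := (@lebesgue_measure R).
Notation chebU := (@chebU R).
Notation wgt := (@wgt R).
Notation I11 := (@I11 R).
Implicit Types f g : R -> R.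

Lemma inH_lin (a b : R) f g : inH f -> inH g -> inH (fun x => a * f x + b * g x).
Proof.
move=> Hf Hg; have [m i] := L2w_lin a b (inH_L2w Hf) (inH_L2w Hg).
case: Hf Hg => _ ef _ [_ eg _]; split=> // x Ix.
by rewrite ef// eg.
Qed.

Lemma inH_scale (a : R) f : inH f -> inH (fun x => a * f x).
Proof.
move=> Hf; have := inH_lin a 0 Hf Hf.
by congr inH; apply/funext => x; rewrite mul0r addr0.
Qed.

Lemma coef_lin (a b : R) n f g : inH f -> inH g ->
  coef n (fun x => a * f x + b * g x) = a * coef n f + b * coef n g.
Proof.
move=> /inH_L2w Lf /inH_L2w Lg; rewrite !coef_ip ip_linl//; first ring.
exact: bdd_chebU.
Qed.

Lemma coef_scale (a : R) n f : inH f -> coef n (fun x => a * f x) = a * coef n f.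
Proof.
move=> Hf; rewrite -[RHS]addr0 -(mul0r (coef n f)) -coef_lin//.
by congr coef; apply/funext => x; rewrite mul0r addr0.
Qed.

Definition dterm f (m : nat) : R := pi / 8 * (2 * m%:R + 1) * (coef (2 * m) f) ^+ 2.

Lemma dweight_ge0 (m : nat) : 0 <= pi / 8 * (2 * m%:R + 1) :> R.
Proof. by rewrite mulr_ge0 ?divr_ge0 ?pi_ge0// addr_ge0// mulr_ge0. Qed.

Lemma dterm_ge0 f m : 0 <= dterm f m.
Proof. by rewrite mulr_ge0 ?sqr_ge0 ?dweight_ge0. Qed.

Lemma drag_ge0 f : (0 <= drag f)%E.
Proof. by apply: nneseries_ge0 => n _ _; rewrite lee_fin dterm_ge0. Qed.

(** Finite sums pass to termwise limits of the coefficients, so this form carries the lower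
    semicontinuity of the drag. *)
Lemma drag_leP f (c : R) :
  (drag f <= c%:E)%E <-> forall N, \sum_(m < N) dterm f m <= c.
Proof.
have d0 n : true -> (0 <= (dterm f n)%:E)%E by rewrite lee_fin dterm_ge0.
split=> [h N|h].
  rewrite -lee_fin; apply: le_trans h; rewrite -sumEFin.
  apply: le_trans (nneseries_lim_ge N (fun n _ => d0 n)).
  by rewrite big_mkord.
apply: lime_le; first by apply: is_cvg_nneseries => n _; exact: d0.
by apply: nearW => N; rewrite sumEFin lee_fin big_mkord.
Qed.

(** Stated in the extended reals so that finiteness of both left-hand drags can be deduced from
    it. *)
Lemma drag_parallelogram f g : inH f -> inH g ->
  (drag (fun x => 2^-1 * f x + 2^-1 * g x)%R
   + drag (fun x => 2^-1 * f x + (- 2^-1) * g x)%R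
   = (2^-1)%:E * drag f + (2^-1)%:E * drag g)%E.
Proof.
move=> Hf Hg; rewrite /drag -!nneseriesZl; try by move=> i _; rewrite lee_fin dterm_ge0.
have h0 h n : (0 <= (2^-1)%:E * (dterm h n)%:E)%E.
  by rewrite -EFinM lee_fin mulr_ge0// dterm_ge0.
rewrite -!nneseriesD; try by move=> i _ _; rewrite ?lee_fin ?dterm_ge0//; exact: h0.
apply: eq_eseriesr => i _; rewrite !coef_lin// -!EFinM -!EFinD; congr EFin.
by field.
Qed.

Lemma drag_scale (c : R) f : inH f ->
  drag (fun x => c * f x) = ((c ^+ 2)%:E * drag f)%E.
Proof.
move=> Hf; rewrite /drag -nneseriesZl; last by move=> i _; rewrite lee_fin dterm_ge0.
by apply: eq_eseriesr => i _; rewrite coef_scale// -EFinM; congr EFin; ring.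
Qed.

(** * The bending moment as a seminorm, and a first admissible pair *)

Lemma tent_lipschitz (xi zeta x : R) : `|tent xi x - tent zeta x| <= `|xi - zeta|.
Proof.
rewrite /tent ler_norml.
have := ler_norm (xi - zeta); have := ler_norm (zeta - xi); rewrite (distrC zeta) => h1 h2.
have h3 := normr_ge0 (xi - zeta).
case: (leP (x - xi) 0) => h4; case: (leP (x - zeta) 0) => h5; apply/andP; split; lra.
Qed.

(** Continuity in xi makes the absolute moment integrable on the unit interval, so that [moment] is
    a real number. *)
Lemma continuous_ip_tent f : L2w f -> continuous (fun xi => ip f (tent xi)).
Proof.
move=> Lf xi; apply/cvgrPdist_le => e e0.
have n1 : 0 < nrm1 f + 1 by rewrite ltr_wpDl ?nrm1_ge0.
near=> zeta.
have -> : ip f (tent xi) - ip f (tent zeta) =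
    ip f (fun x => 1 * tent xi x + (-1) * tent zeta x).
  by rewrite ip_linr ?mul1r ?mulN1r//; exact: bdd_tent.
apply: (@le_trans _ _ (`|xi - zeta| * nrm1 f)).
  apply: ip_le_nrm1 => //; first by apply: bdd_lin; exact: bdd_tent.
  by move=> x _; rewrite mul1r mulN1r; exact: tent_lipschitz.
apply: (@le_trans _ _ (e / (nrm1 f + 1) * nrm1 f)).
  apply: ler_wpM2r; first exact: nrm1_ge0.
  near: zeta; apply: (@cvgr_dist_le _ _ _ _ _ id xi); first exact: cvg_id.
  exact: divr_gt0.
rewrite mulrAC ler_pdivrMr// ler_wpM2l ?ltW//.
by rewrite ltrDl.
Unshelve. all: by end_near. Qed.

Definition Mom f : R := Rintegral mu `]0, 1[%classic (fun xi => `|ip f (tent xi)|).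

Let m01 : measurable (`]0, 1[%classic : set (measurableTypeR R)).
Proof. exact: measurable_itv. Qed.

Lemma integrable_Mom f : L2w f ->
  mu.-integrable `]0, 1[%classic (EFin \o (fun xi => `|ip f (tent xi)|)).
Proof.
move=> Lf; apply: integrableS (integrable_segment 0 1 _) => //.
  exact: subset_itv_oo_cc.
move=> x; apply: (@continuous_comp _ _ _ (fun xi => ip f (tent xi)) Num.norm).
  exact: continuous_ip_tent.
exact: norm_continuous.
Qed.

Lemma momentE b f : L2w f -> moment b f = (b ^+ 3 / 4 * Mom f)%:E.
Proof.
move=> Lf; rewrite /moment [RHS]EFinM; congr (_ * _)%E.
rewrite /Mom /Rintegral fineK; last by have := integrable_fin_num m01 (integrable_Mom Lf).
apply: eq_integral => x; rewrite inE/= in_itv/= => /andP[x0 _].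
by rewrite inner_momentE// ltW.
Qed.

Lemma Mom_lin (a b : R) f g : L2w f -> L2w g ->
  Mom (fun x => a * f x + b * g x) <= `|a| * Mom f + `|b| * Mom g.
Proof.
move=> Lf Lg; have fi := integrable_Mom Lf; have gi := integrable_Mom Lg.
have sc c h : L2w h -> mu.-integrable `]0, 1[%classic (EFin \o (fun xi => c * `|ip h (tent xi)|)).
  move=> Lh; have := integrableZl m01 c (integrable_Mom Lh).
  by apply: eq_integrable; [exact: m01|move=> x _ /=; rewrite EFinM].
rewrite /Mom -!(RintegralZl _ m01)// -RintegralD//; [|exact: sc|exact: sc].
apply: le_Rintegral => //.
- by apply: integrable_Mom; exact: L2w_lin.
- have := integrableD m01 (sc `|a| f Lf) (sc `|b| g Lg).
  by apply: eq_integrable; [exact: m01|move=> x _ /=; rewrite EFinD].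
- move=> xi _; rewrite ip_linl//; last exact: bdd_tent.
  by rewrite (le_trans (ler_normD _ _))// !normrM.
Qed.

Lemma Mom_scale (a : R) f : L2w f -> Mom (fun x => a * f x) = `|a| * Mom f.
Proof.
move=> Lf; rewrite /Mom -(RintegralZl _ m01); last exact: integrable_Mom.
apply: eq_Rintegral => xi _; rewrite -normrM; congr (`| _ |).
rewrite -[RHS]addr0 -(mul0r (ip f (tent xi))) -ip_linl//; last exact: bdd_tent.
by apply: eq_ip => // x _; rewrite mul0r addr0.
Qed.

Lemma Mom_le (C : R) f : L2w f ->
  (forall xi, 0 < xi < 1 -> `|ip f (tent xi)| <= C) -> Mom f <= C.
Proof.
move=> Lf fC; have fi := integrable_Mom Lf.
have -> : C = Rintegral mu `]0, 1[%classic (fun=> C).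
  transitivity (C * fine (mu `]0, 1[%classic)).
    by rewrite lebesgue_measure_itv/= lte_fin ltr01 oppr0 adde0 mulr1.
  by rewrite Rintegral_cst//; exact: m01.
apply: le_Rintegral => //.
  by apply: integrableS (integrable_segment 0 1 (@cst_continuous _ _ C)) => //; exact: subset_itv_oo_cc.
Qed.

Lemma Mom_ge0 f : 0 <= Mom f.
Proof. exact: Rintegral_ge0. Qed.

Lemma Mom_coef_bound f s : inH f -> 0 < s ->
  (forall N, \sum_(m < N) coef (2 * m) f ^+ 2 <= s ^+ 2) ->
  Mom f <= pi / 2 * 3 * s.
Proof.
move=> Hf s0 h; apply: Mom_le; first exact: inH_L2w.
move=> xi /andP[xi0 xi1].
have xi01 : 0 <= xi <= 1 by rewrite !ltW.
(* The 2 bounds the tent on [I11], the 1 is the approximation margin of [ip_bound]. *)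
rewrite (_ : 3 = 2 + 1 :> R); last by ring.
apply: ip_bound => //; first exact: bdd_tent.
- exact: tent_polyapprox.
- by move=> x; exact: tent_bound.
Qed.

Lemma admissible1P (b0 b : R) f : admissible1 b0 b f <->
  [/\ 0 < b /\ b <= b0, inH f, (drag f < +oo)%E, coef 0 f = 4 / (pi * b) &
   b ^+ 3 / 4 * Mom f <= 1].
Proof.
split=> -[? Hf ? ?]; have Lf := inH_L2w Hf.
  by rewrite momentE// lee_fin.
by split=> //; rewrite momentE// lee_fin.
Qed.

(** Elliptic loading (constant f) on a short span: the moment is b^2 * Mom 1 / pi <= b^2, so a small
    b satisfies the constraint. *)
Lemma admissible1_nonempty (b0 : R) : 0 < b0 -> exists b f, admissible1 b0 b f.
Proof.
move=> b00; pose b := Num.min b0 (2^-1).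
have bp : 0 < b by rewrite lt_min b00 invr_gt0/=.
have pip := pi_gt0 R.
pose c : R := 4 / (pi * b).
have c0 : 0 <= c by rewrite divr_ge0// ltW// mulr_gt0.
have H1 : inH (fun=> 1 : R).
  by have [? ?] := bdd_L2w (@bdd_cst R 1); split.
have Hc := inH_scale c H1.
have cf n : coef n (fun=> 1 : R) = (n == 0)%N%:R.
  rewrite coef_ip (_ : (fun=> 1) = chebU 0)// ip_chebU eq_sym.
  by move: (pi : R) pip => p p0; field; rewrite gt_eqF.
exists b, (fun=> c * 1); apply/admissible1P; split=> //.
- by rewrite ge_min lexx.
- apply: (@le_lt_trans _ _ (pi / 8 * c ^+ 2)%:E); last exact: ltry.
  apply/drag_leP => N.
  case: N => [|N]; first by rewrite big_ord0 mulr_ge0 ?sqr_ge0// divr_ge0// ltW.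
  rewrite big_ord_recl big1 ?addr0; last first.
    by move=> i _; rewrite /dterm coef_scale// cf/= mulr0 expr0n/= mulr0.
  by rewrite /dterm coef_scale// cf/= mulr1 mulr0 add0r mulr1.
- by rewrite coef_scale// cf/= mulr1.
- rewrite Mom_scale; last exact: inH_L2w.
  rewrite (ger0_norm c0).
  have M1 : Mom (fun=> 1 : R) <= 2 * (pi / 2).
    apply: Mom_le => [|xi /andP[xi0 xi1]]; first exact: inH_L2w.
    have xi01 : 0 <= xi <= 1 by rewrite !ltW.
    apply: le_trans (ip_le_nrm1 (inH_L2w H1) (bdd_tent xi) (fun x Ix => tent_bound xi01 Ix)) _.
    rewrite ler_wpM2l// /nrm1 -integral_wgt le_eqVlt; apply/orP; left; apply/eqP.
    by apply: eq_Rintegral => x _; rewrite normr1 mul1r.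
  have b2 : b <= 2^-1 by rewrite ge_min lexx orbT.
  have M0 := Mom_ge0 (fun=> 1).
  have -> : b ^+ 3 / 4 * (c * Mom (fun=> 1)) = b ^+ 2 * (Mom (fun=> 1) / pi).
    rewrite /c; move: (pi : R) pip => p p0; field.
    by rewrite !gt_eqF.
  have : Mom (fun=> 1 : R) / pi <= 1 by rewrite ler_pdivrMr// mul1r; lra.
  have : 0 <= Mom (fun=> 1 : R) / pi by rewrite divr_ge0// ltW.
  have : b ^+ 2 <= 1 by nra.
  have := sqr_ge0 b; nra.
Qed.

End Functionals.

(** * The minimizing sequence *)

Section Minimizer.
Variable R : realType.
Implicit Types f g : R -> R.

(** Since [fine] sends +oo to 0, upper bounds on [Dr] are informative only together with
    [drag f < +oo]. *)
Definition Dr f : R := fine (drag f).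

Lemma DrE f : (drag f < +oo)%E -> drag f = (Dr f)%:E.
Proof. by move=> h; rewrite fineK// ge0_fin_numE// drag_ge0. Qed.

Lemma Dr_ge0 f : 0 <= Dr f. Proof. exact/fine_ge0/drag_ge0. Qed.

Lemma dterm_le_Dr f N : (drag f < +oo)%E -> \sum_(m < N) dterm f m <= Dr f.
Proof. by move=> h; move: N; apply/drag_leP; rewrite DrE. Qed.

Lemma Dr_scale (c : R) f : inH f -> (drag f < +oo)%E ->
  (drag (fun x => c * f x)%R < +oo)%E /\ Dr (fun x => c * f x) = c ^+ 2 * Dr f.
Proof.
move=> Hf fy; have e := drag_scale c Hf; rewrite (DrE fy) -EFinM in e.
by rewrite /Dr e ltry.
Qed.

Lemma Dr_parallelogram f g : inH f -> inH g -> (drag f < +oo)%E -> (drag g < +oo)%E ->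
  [/\ (drag (fun x => 2^-1 * f x + 2^-1 * g x)%R < +oo)%E,
      (drag (fun x => 2^-1 * f x + (- 2^-1) * g x)%R < +oo)%E &
      Dr (fun x => 2^-1 * f x + 2^-1 * g x)
      + Dr (fun x => 2^-1 * f x + (- 2^-1) * g x) = (Dr f + Dr g) / 2].
Proof.
move=> Hf Hg fy gy; rewrite {1 2}/Dr.
have := drag_parallelogram Hf Hg; rewrite (DrE fy) (DrE gy) -!EFinM -EFinD.
have := drag_ge0 (fun x => 2^-1 * f x + (- 2^-1) * g x).
have := drag_ge0 (fun x => 2^-1 * f x + 2^-1 * g x).
move: (drag (fun x => 2^-1 * f x + 2^-1 * g x)) => A A0.
move: (drag (fun x => 2^-1 * f x + (- 2^-1) * g x)) => B B0 AB.
have Ay : (A < +oo)%E by apply: (le_lt_trans (leeDl A B0)); rewrite AB ltry.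
have By : (B < +oo)%E by apply: (le_lt_trans (leeDr B A0)); rewrite AB ltry.
split=> //; rewrite -fineD ?ge0_fin_numE// AB/=.
by rewrite mulrDl ![2^-1 * _]mulrC.
Qed.

Lemma cvg_weighted_sqr (w : nat -> R) (c : nat -> nat -> R) (a : nat -> R) N :
  (forall j, c ^~ j @ \oo --> a j) ->
  (fun k => \sum_(j < N) w j * c k j ^+ 2) @ \oo --> \sum_(j < N) w j * a j ^+ 2.
Proof.
move=> ca; elim: N => [|N IH].
  rewrite big_ord0 (_ : (fun k => _) = fun=> 0); first exact: cvg_cst.
  by apply/funext => k; rewrite big_ord0.
rewrite big_ord_recr/= (_ : (fun k => _) =
  (fun k => \sum_(j < N) w j * c k j ^+ 2 + w N * c k N ^+ 2)); last first.
  by apply/funext => k; rewrite big_ord_recr.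
apply: cvgD; first exact: IH.
apply: cvgM; first exact: cvg_cst.
exact: (cvg_comp _ _ (ca N) (@exprn_continuous _ _ _)).
Qed.

Lemma cvg_le_cst (u : nat -> R) (l C : R) n0 : u @ \oo --> l ->
  (forall n, (n0 <= n)%N -> u n <= C) -> l <= C.
Proof.
move=> ul uC; apply: (cvgr_to_le ul); near=> n; apply: uC.
by near: n; exists n0.
Unshelve. all: by end_near. Qed.

(** M is the infimum, G and H two nearly minimal drags, Y and X those of midpoint and
    half-difference. As Y >= M / (1 + d), X <= M + d - M / (1 + d) <= d + M d. *)
Lemma midpoint_defect (d M G H X Y : R) : 0 < d -> 0 <= M ->
  G <= M + d -> H <= M + d -> Y + X = (G + H) / 2 -> M <= (1 + d) * Y ->
  X <= (M + 1) * d.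
Proof. nra. Qed.

(** * The infimum and the spans of nearly minimizing pairs *)

Variable b0 : R.
Hypothesis b00 : 0 < b0.

Definition drag_values := [set d : R | exists b f, admissible1 b0 b f /\ d = Dr f].

Notation m := (inf drag_values).

Lemma has_inf_drag : has_inf drag_values.
Proof.
split; last by exists 0 => _ [b [f [_ ->]]]; exact: Dr_ge0.
by have [b [f h]] := admissible1_nonempty b00; exists (Dr f), b, f.
Qed.

Lemma inf_drag_le b f : admissible1 b0 b f -> m <= Dr f.
Proof. by move=> h; apply: ge_inf; [case: has_inf_drag|exists b, f]. Qed.

Lemma inf_drag_ge0 : 0 <= m.
Proof.
apply: lb_le_inf; first by case: has_inf_drag.
by move=> _ [b [f [_ ->]]]; exact: Dr_ge0.
Qed.

Lemma inf_drag_adherent e : 0 < e -> exists b f, admissible1 b0 b f /\ Dr f < m + e.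
Proof.
by move=> e0; have [_ [b [f [h ->]]] lt] := inf_adherent e0 has_inf_drag; exists b, f.
Qed.

(** A drag at most m + 1 forces b^2 >= 2 / (pi (m + 1)); for b < 1 also b >= b^2, so the cap at 1
    replaces a square root. *)
Definition min_span : R := Num.min 1 (2 / (pi * (m + 1))).

Lemma min_span_gt0 : 0 < min_span.
Proof.
have m0 := inf_drag_ge0.
by rewrite lt_min ltr01/= divr_gt0// mulr_gt0 ?pi_gt0// ltr_wpDl.
Qed.

(* The lift constraint forces [2 / (pi * b ^+ 2) <= Dr f]. *)
Lemma min_span_le b f : admissible1 b0 b f -> Dr f <= m + 1 -> min_span <= b.
Proof.
move=> /admissible1P[[bp _] Hf fy c0 _] fm; have m0 := inf_drag_ge0.
have := dterm_le_Dr 1 fy; rewrite big_ord1 /dterm muln0 c0 mulr0 add0r mulr1 => h.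
have {}h := le_trans h fm.
have pip := pi_gt0 R.
have m1 : 0 < m + 1 by rewrite ltr_wpDl.
have h2 : 2 / (pi * (m + 1)) <= b ^+ 2.
  rewrite ler_pdivrMr ?mulr_gt0//.
  have e : pi / 8 * (4 / (pi * b)) ^+ 2 = 2 / (pi * b ^+ 2) :> R.
    by move: (pi : R) pip => p p0; field; rewrite !gt_eqF.
  rewrite e ler_pdivrMr in h; last by rewrite mulr_gt0 ?exprn_gt0.
  by apply: le_trans h _; rewrite le_eqVlt; apply/orP; left; apply/eqP; ring.
rewrite ge_min; have [b1|b1] := leP 1 b; rewrite ?b1//=.
by apply: le_trans h2 _; rewrite expr2 ger_pMr// ltW.
Qed.

Lemma limit_span_exists : exists bs, [/\ 0 < bs, bs <= b0 & forall e, 0 < e ->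
  exists b f, [/\ admissible1 b0 b f, Dr f < m + e & `|bs - b| < e]].
Proof.
have ms0 := min_span_gt0.
have /choice[bf bfP] : forall n : nat, exists p : R * (R -> R),
    admissible1 b0 p.1 p.2 /\ Dr p.2 < m + n.+1%:R^-1.
  move=> n; have [|b [f h]] := @inf_drag_adherent n.+1%:R^-1; first by rewrite invr_gt0.
  by exists (b, f).
have inI n : min_span <= (bf n).1 <= b0.
  have [h1 h2] := bfP n; apply/andP; split; last by case/admissible1P : h1 => -[].
  apply: min_span_le h1 _; apply/ltW/(lt_le_trans h2).
  by rewrite lerD2l invf_le1// ler1n.
have FI : ((fun n => (bf n).1) @ \oo) `[min_span, b0]%classic.
  by exists 0%N => // n _ /=; rewrite in_itv; exact: inI.
have [bs [/= bsI bsC]] := segment_compact _ FI.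
move: bsI; rewrite in_itv/= => /andP[bs1 bs2].
exists bs; split=> //; first exact: lt_le_trans bs1.
move=> e e0.
have [N Ne] : exists N : nat, e^-1 < N%:R.
  by exists (Num.truncn e^-1).+1; exact: truncnS_gt.
have [||x [[n /= Nn <-]]] := bsC [set (bf n).1 | n in [set n | (N <= n)%N]] (ball bs e).
- by exists N => // n /= Nn; exists n.
- exact: nbhsx_ballx.
move=> bx; have [h1 h2] := bfP n; exists (bf n).1, (bf n).2; split=> //.
apply: lt_le_trans h2 _; rewrite lerD2l invf_ple ?posrE//.
apply: le_trans (ltW Ne) _; rewrite ler_nat; exact: leq_trans Nn _.
Qed.

Section LimitSpan.
Variable bs : R.
Hypotheses (bs0 : 0 < bs) (bsb0 : bs <= b0).

(** The lift is exact, so midpoints keep it; the slack d sits in drag and moment only, and the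
    notion weakens as d grows. *)
Definition near_minimizer (d : R) g :=
  [/\ inH g, (drag g < +oo)%E, coef 0 g = 4 / (pi * bs),
   Dr g <= m + d & bs ^+ 3 / 4 * Mom g <= 1 + d].

(* [r * f] with [r = b / bs] keeps the lift at span [bs] and scales the drag by
   [r ^+ 2] and the moment by [r ^- 2]. *)
Lemma near_minimizer_exists d : 0 < d <= 1 ->
  (forall e, 0 < e ->
    exists b f, [/\ admissible1 b0 b f, Dr f < m + e & `|bs - b| < e]) ->
  exists g, near_minimizer d g.
Proof.
move=> /andP[d0 d1] bsP; have pip := pi_gt0 R.
have m0 := inf_drag_ge0.
(* The rescaled drag is at most (1 + k) (m + k) <= m + k (m + 2) = m + d. *)
pose k := d / (m + 2).
have m2 : 2 <= m + 2 by rewrite lerDr.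
have k0 : 0 < k by rewrite divr_gt0//; lra.
have kd : k * (m + 2) = d by rewrite divfK// gt_eqF//; lra.
have km0 : 0 <= k * m by rewrite mulr_ge0// ltW.
(* Needed for (1 - 2/3 k) (1 + k) >= 1, which turns the lower bound on r^2 into a moment factor of
   at most 1 + k. *)
have k12 : k <= 2^-1 by move: kd; rewrite mulrDr; lra.
have [|b [f [adm Df bb]]] := bsP (k / 3 * Num.min 1 bs).
  by rewrite mulr_gt0 ?lt_min ?ltr01 ?bs0// divr_gt0.
have mins : Num.min 1 bs <= bs by rewrite ge_min lexx orbT.
have min1 : Num.min 1 bs <= 1 by rewrite ge_min lexx.
have min0 : 0 < Num.min 1 bs by rewrite lt_min ltr01.
have {}Df : Dr f <= m + k by nra.
pose r := b / bs.
have bE : b = r * bs by rewrite /r divfK// gt_eqF.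
have [[b_gt0 _] Hf fy cf Mf] := (admissible1P _ _ _).1 adm.
have r0 : 0 < r by rewrite divr_gt0.
have rk : `|1 - r| <= k / 3.
  rewrite -(ler_pM2r bs0) -[X in _ * X <= _](gtr0_norm bs0) -normrM mulrBl mul1r -bE.
  by apply: le_trans (ltW bb) _; rewrite ler_wpM2l// divr_ge0// ltW.
move: rk; rewrite ler_norml => /andP[rk1 rk2].
have r2u : r ^+ 2 <= 1 + k by nra.
have r2l : 1 <= r ^+ 2 * (1 + k).
  have r2l' : 1 - 2 / 3 * k <= r ^+ 2 by have := sqr_ge0 (r - 1); nra.
  apply: (@le_trans _ _ ((1 - 2 / 3 * k) * (1 + k))); first by nra.
  by apply: ler_wpM2r => //; lra.
have [gy Dg] := Dr_scale r Hf fy.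
exists (fun x => r * f x); split.
- exact: inH_scale.
- exact: gy.
- rewrite coef_scale// cf bE; move: (pi : R) pip => p p0.
  by field; rewrite !gt_eqF.
- rewrite Dg; move: kd (Dr_ge0 f) Df m0; move: (Dr f) m => D M *.
  nra.
- rewrite Mom_scale; last exact: inH_L2w.
  rewrite (gtr0_norm r0).
  have Me : b ^+ 3 / 4 * Mom f = r ^+ 2 * (bs ^+ 3 / 4 * (r * Mom f)).
    by rewrite bE; ring.
  rewrite Me in Mf.
  have M0 : 0 <= bs ^+ 3 / 4 * (r * Mom f).
    apply: mulr_ge0; first by rewrite divr_ge0// exprn_ge0// ltW.
    by rewrite mulr_ge0 ?Mom_ge0// ltW.
  apply: (@le_trans _ _ (1 + k)); last by nra.
  have h : (bs ^+ 3 / 4 * (r * Mom f)) * 1 <= (bs ^+ 3 / 4 * (r * Mom f)) * (r ^+ 2 * (1 + k)) by exact: ler_wpM2l.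
  nra.
Qed.

(* Parallelogram law; shrinking the span by [K = sqrt (1 + d)] makes the
   midpoint of two near-minimizers admissible. *)
Lemma near_minimizer_close d g h : 0 < d <= 1 ->
  near_minimizer d g -> near_minimizer d h ->
  (drag (fun x => 2^-1 * g x + (- 2^-1) * h x)%R < +oo)%E /\
  Dr (fun x => 2^-1 * g x + (- 2^-1) * h x) <= (m + 1) * d.
Proof.
have pip := pi_gt0 R.
have m0 := inf_drag_ge0.
have half2 : 2^-1 + 2^-1 = 1 :> R by lra.
move=> /andP[d0 d1] [Hg gy cg Dg Mg] [Hh hy ch Dh Mh].
have [my dy e] := Dr_parallelogram Hg Hh gy hy; split; first exact: dy.
have Hm := inH_lin 2^-1 2^-1 Hg Hh.
have cm := coef_lin 2^-1 2^-1 0 Hg Hh.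
have Mm := Mom_lin 2^-1 2^-1 (inH_L2w Hg) (inH_L2w Hh).
move: (fun x => 2^-1 * g x + 2^-1 * h x) my e Hm cm Mm => mid my e Hm cm Mm.
move: (Dr (fun x => _ + _)) e => X e.
have Lm := inH_L2w Hm.
rewrite cg ch -mulrDl half2 mul1r in cm.
rewrite [`|2^-1|]ger0_norm ?invr_ge0// -mulrDr in Mm.
have {}Mm : bs ^+ 3 / 4 * Mom mid <= 1 + d.
  have bq : 0 <= bs ^+ 3 / 4 by rewrite divr_ge0// exprn_ge0// ltW.
  apply: le_trans (ler_wpM2l bq Mm) _.
  by rewrite mulrCA mulrC ler_pdivrMr// mulr_natr mulr2n mulrDr lerD.
pose K := Num.sqrt (1 + d).
have K2 : K ^+ 2 = 1 + d by rewrite sqr_sqrtr// addr_ge0// ltW.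
have K1 : 1 <= K by rewrite -sqrtr1 ler_wsqrtr// lerDl ltW.
have K0 : 0 < K by apply: lt_le_trans K1.
have [sy Ds] := Dr_scale K Hm my.
(* The moment is divided by K^2 = 1 + d, which cancels its slack; the drag is multiplied by the same
   1 + d, the factor in [midpoint_defect]. *)
have adm : admissible1 b0 (bs / K) (fun x => K * mid x).
  apply/admissible1P; split=> //.
  - split; first exact: divr_gt0.
    by apply: le_trans bsb0; rewrite ler_pdivrMr// ler_peMr// ltW.
  - exact: inH_scale.
  - rewrite coef_scale// cm; move: (pi : R) pip => p p0.
    by field; rewrite !gt_eqF.
  - rewrite Mom_scale// gtr0_norm//.
    have -> : (bs / K) ^+ 3 / 4 * (K * Mom mid) = (bs ^+ 3 / 4 * Mom mid) / K ^+ 2.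
      by field; rewrite gt_eqF.
    by rewrite ler_pdivrMr ?exprn_gt0// mul1r K2.
have := inf_drag_le adm; rewrite Ds K2.
exact: midpoint_defect d0 inf_drag_ge0 Dg Dh e.
Qed.

End LimitSpan.

Lemma drag_minimizer : exists (bt : R) (ft : R -> R), admissible1 b0 bt ft /\
  (forall (b : R) (f : R -> R), admissible1 b0 b f -> (drag ft <= drag f)%E).
Proof.
have [bs [bs0 bsb0 bsP]] := limit_span_exists.
have pip := pi_gt0 R.
have m0 := inf_drag_ge0.
pose dl (k : nat) : R := k.+1%:R^-1.
have dl01 k : 0 < dl k <= 1 by rewrite invr_gt0 ltr0n/= invf_le1// ler1n.
have dl_small e : 0 < e -> exists N : nat, forall k, (N <= k)%N -> dl k <= e.
  move=> e0; exists (Num.truncn e^-1) => k Nk.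
  rewrite /dl invf_ple ?posrE//; apply: ltW; apply: lt_le_trans (truncnS_gt _) _.
  by rewrite ler_nat.
have /choice[g gP] k : exists g, near_minimizer bs (dl k) g by exact: near_minimizer_exists.
pose c k j := coef (2 * j) (g k).
have gH k : inH (g k) by case: (gP k).
(* The division by 4 is the square of the 2^-1 in the half-difference. *)
have pairP k l N : (k <= l)%N ->
    \sum_(j < N) (pi / 8 * (2 * j%:R + 1) / 4) * (c k j - c l j) ^+ 2 <= (m + 1) * dl k.
  move=> kl; have gl : near_minimizer bs (dl k) (g l).
    have dkl : dl l <= dl k by rewrite lef_pV2 ?posrE// ler_nat.
    by case: (gP l) => ? ? ? ? ?; split=> //; lra.
  have [dy le] := near_minimizer_close bs0 bsb0 (dl01 k) (gP k) gl.
  apply: le_trans le; apply: le_trans (dterm_le_Dr N dy).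
  rewrite le_eqVlt; apply/orP; left; apply/eqP; apply: eq_bigr => j _.
  by rewrite /dterm coef_lin// -/(c k j) -/(c l j); field.
have cvgc j : cvgn (c ^~ j).
  apply/cauchy_cvgP/cauchy_exP => e e0 /=.
  pose w : R := pi / 8 * (2 * j%:R + 1) / 4.
  have w0 : 0 < w.
    by rewrite divr_gt0// mulr_gt0 ?divr_gt0// ltr_wpDl// mulr_ge0.
  have m1 : 0 < m + 1 by rewrite ltr_wpDl.
  (* The spare factor 1/2 yields the strict inequality that membership in a ball requires. *)
  have [|N HN] := dl_small (w * e ^+ 2 / 2 / (m + 1)).
    by rewrite !divr_gt0// mulr_gt0// exprn_gt0.
  exists (c N j); exists N => // l /= Nl; rewrite /ball/=.
  have := pairP N l j.+1 Nl; rewrite big_ord_recr/= -/w => h.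
  have h1 : w * (c N j - c l j) ^+ 2 <= (m + 1) * dl N.
    apply: le_trans h; rewrite lerDr; apply: sumr_ge0 => i _.
    by rewrite mulr_ge0 ?sqr_ge0// divr_ge0// dweight_ge0.
  have h2 : (m + 1) * dl N <= w * e ^+ 2 / 2.
    by rewrite mulrC -ler_pdivlMr//; exact: HN.
  have h3 : (c N j - c l j) ^+ 2 < e ^+ 2.
    rewrite -(ltr_pM2l w0); apply: le_lt_trans (le_trans h1 h2) _.
    by rewrite ltr_pdivrMr// ltr_pMr ?ltr1n// mulr_gt0// exprn_gt0.
  move: h3; rewrite -(real_normK (num_real (c N j - c l j))).
  by rewrite ltr_pXn2r ?nnegrE ?(ltW e0).
pose a j := limn (c ^~ j).
have ca j : c ^~ j @ \oo --> a j by exact: cvgc.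
have aD N : \sum_(j < N) (pi / 8 * (2 * j%:R + 1)) * a j ^+ 2 <= m.
  apply/ler_addgt0Pr => e e0; have [n0 Hn0] := dl_small _ e0.
  have hc := @cvg_weighted_sqr (fun j => pi / 8 * (2 * j%:R + 1)) c a N ca.
  apply: (@cvg_le_cst _ _ _ n0 hc).
  move=> n n0n; have [_ gy _ Dg _] := gP n.
  apply: le_trans (dterm_le_Dr N gy) _.
  by apply: le_trans Dg _; rewrite lerD2l; exact: Hn0.
have aS N : \sum_(j < N) (2 * j%:R + 1) * a j ^+ 2 <= m / (pi / 8).
  rewrite ler_pdivlMr ?divr_gt0//; apply: le_trans (aD N).
  rewrite mulr_suml le_eqVlt; apply/orP; left; apply/eqP.
  by apply: eq_bigr => j _; ring.
pose f := synth a.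
have Hf : inH f := inH_synth aS.
have cf j : coef (2 * j) f = a j := coef_synth aS j.
have fm : (drag f <= m%:E)%E.
  apply/drag_leP => N; apply: le_trans (aD N).
  by rewrite le_eqVlt; apply/orP; left; apply/eqP; apply: eq_bigr => j _; rewrite /dterm cf.
(* Let l tend to infinity in [pairP] with N fixed. Every weight is at least that of j = 0, namely pi
   / 32, whence the constant. *)
have limP k N : \sum_(j < N) (c k j - a j) ^+ 2 <= 32 / pi * (m + 1) * dl k.
  have h : \sum_(j < N) (pi / 8 * (2 * j%:R + 1) / 4) * (c k j - a j) ^+ 2 <= (m + 1) * dl k.
    have hd j : (fun l => c k j - c l j) @ \oo --> c k j - a j.
      by apply: cvgB; [exact: cvg_cst|exact: ca].
    have hc := @cvg_weighted_sqr (fun j => pi / 8 * (2 * j%:R + 1) / 4)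
      (fun l j => c k j - c l j) _ N hd.
    apply: (@cvg_le_cst _ _ _ k hc).
    by move=> l kl; exact: pairP.
  rewrite -mulrA -ler_pdivrMl ?divr_gt0//; apply: le_trans h.
  rewrite mulr_sumr; apply: ler_sum => j _; rewrite ler_wpM2r ?sqr_ge0//.
  rewrite invf_div; have : 0 <= j%:R :> R by []. nra.
exists bs, f; split; last first.
  move=> b f' adm; apply: le_trans fm _.
  have [_ _ fy _ _] := (admissible1P _ _ _).1 adm.
  by rewrite (DrE fy) lee_fin (inf_drag_le adm).
apply/admissible1P; split=> //.
- exact: le_lt_trans fm (ltry _).
- rewrite -(muln0 2) cf; apply: (cvg_unique _ (ca 0%N)) => //.
  rewrite (_ : c ^~ 0%N = fun=> 4 / (pi * bs)); first exact: cvg_cst.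
  by apply/funext => k; rewrite /c muln0; case: (gP k).
- apply/ler_addgt0Pr => e e0.
  pose C := bs ^+ 3 / 4 * (pi / 2 * 3).
  have C0 : 0 <= C by rewrite !mulr_ge0 ?divr_ge0 ?exprn_ge0// ltW.
  (* The excess moment has two parts: the slack [dl k] <= s of [g k], and at most C * s from the
     difference of f and [g k]. *)
  pose s := e / (C + 1).
  have C1 : 0 < C + 1 by rewrite ltr_wpDl.
  have s0 : 0 < s by rewrite divr_gt0.
  have se : s * (C + 1) = e by rewrite /s divfK// gt_eqF.
  have m1 : 0 < m + 1 by rewrite ltr_wpDl.
  have q0 : 0 < 32 / pi * (m + 1) by rewrite mulr_gt0 ?divr_gt0.
  have [|N1 HN1] := dl_small (s ^+ 2 / (32 / pi * (m + 1))).
    by rewrite divr_gt0// exprn_gt0.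
  have [N2 HN2] := dl_small _ s0.
  pose k := maxn N1 N2.
  have k1 := HN1 k (leq_maxl _ _); have k2 := HN2 k (leq_maxr _ _).
  have [_ _ _ _ Mg] := gP k.
  pose df x := 1 * f x + (-1) * g k x.
  have Hd : inH df by exact: inH_lin.
  have Md : Mom df <= pi / 2 * 3 * s.
    apply: Mom_coef_bound => // N.
    rewrite (eq_bigr (fun j : 'I_N => (c k j - a j) ^+ 2)).
      by apply: le_trans (limP k N) _; rewrite mulrC -ler_pdivlMr.
    by move=> j _; rewrite coef_lin// cf -/(c k j); ring.
  have Mf : Mom f <= Mom (g k) + Mom df.
    have := Mom_lin 1 1 (inH_L2w (gH k)) (inH_L2w Hd).
    rewrite (_ : (fun x => _) = f); first by rewrite normr1 !mul1r.
    by apply/funext => x; rewrite /df; ring.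
  have bq : 0 <= bs ^+ 3 / 4 by rewrite divr_ge0// exprn_ge0// ltW.
  have h2 : bs ^+ 3 / 4 * Mom df <= C * s.
    by rewrite /C -[X in _ <= X]mulrA; exact: ler_wpM2l bq _ _ Md.
  apply: le_trans (ler_wpM2l bq Mf) _; rewrite mulrDr.
  apply: le_trans (lerD Mg h2) _.
  by rewrite -se -addrA lerD2l mulrDr mulr1 (mulrC s) addrC lerD2l.
Qed.

End Minimizer.

Theorem theorem3p1 (R : realType) (b0 : R) (hb0 : 0 < b0) :
  exists (bt : R) (ft : R -> R),
    admissible1 b0 bt ft /\
    (forall (b : R) (f : R -> R), admissible1 b0 b f -> (drag ft <= drag f)%E).
Proof. exact: drag_minimizer. Qed.
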